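(* Let $n\ge 1$ and let $f:\mathbb{D}^n\to\mathbb{G}_n$ be a holomorphic mapping. Then $f$ is proper if and only if there exist finite Blaschke products $B_1,\dots,B_n$ such that $$f(\lambda_1,\dots,\lambda_n)=\pi_n\big(B_1(\lambda_1),\dots,B_n(\lambda_n)\big),\qquad \lambda_1,\dots,\lambda_n\in\mathbb{D}.$$
   Context: $\mathbb{D}$ is the open unit disc in $\mathbb{C}$. The mapping $\pi_n=(\pi_{n,1},\dots,\pi_{n,n}):\mathbb{C}^n\to\mathbb{C}^n$ is given by the elementary symmetric polynomials $\pi_{n,k}(\lambda_1,\dots,\lambda_n)=\sum_{1\le j_1<\dots<j_k\le n}\lambda_{j_1}\cdots\lambda_{j_k}$, $k=1,\dots,n$. The symmetrized $n$-disc is the domain $\mathbb{G}_n=\pi_n(\mathbb{D}^n)\subset\mathbb{C}^n$. A finite Blaschke product is a function $B(\lambda)=c\prod_{j=1}^N\frac{\lambda-a_j}{1-\bar a_j\lambda}$ with $N\ge1$, $|c|=1$, $a_1,\dots,a_N\in\mathbb{D}$. *)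

(* Defs.v *)
From mathcomp Require Import all_boot all_order all_algebra.
From mathcomp Require Import all_classical all_reals all_analysis.
From mathcomp Require Import complex.

Set Implicit Arguments.
Unset Strict Implicit.
Unset Printing Implicit Defensive.

Import Order.TTheory GRing.Theory Num.Theory.
Import numFieldNormedType.Exports.

Local Open Scope classical_set_scope.
Local Open Scope ring_scope.

(* The bare type R[i] carries no topology in the library; the instances are
   attached to the carrier of a numClosedFieldType, which is why the complex
   field is packed here.  Its norm has (nonnegative real) values in Cplx R. *)
Definition Cplx (R : realType) : numClosedFieldType := R[i].

Definition disc (R : realType) : set (Cplx R) := [set z | `|z| < 1].

Definition polydisc (R : realType) (n : nat) : set 'rV[Cplx R]_n :=
  [set z | forall j, disc (z ord0 j)].

(* Indices are shifted: coordinate k : 'I_n holds the (k+1)-st elementary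
   symmetric polynomial.  A choice j_1 < ... < j_(k+1) is the same as a subset
   of 'I_n with k+1 elements. *)
Definition symmap (R : realType) (n : nat) (z : 'rV[Cplx R]_n) :
    'rV[Cplx R]_n :=
  \row_(k < n) \sum_(J : {set 'I_n} | #|J| == k.+1) \prod_(j in J) z ord0 j.

Definition symdisc (R : realType) (n : nat) : set 'rV[Cplx R]_n :=
  @symmap R n @` @polydisc R n.

(* Maps are total functions on C^n and only their values on the domain D
   matter.  D is meant to be open, so that differentiability (over C) of f at
   the points of D depends only on the restriction of f to D. *)
Definition holomorphic_on (R : realType) (m n : nat) (D : set 'rV[Cplx R]_m)
    (f : 'rV[Cplx R]_m -> 'rV[Cplx R]_n) : Prop :=
  forall z, D z -> differentiable f z.

(* For subsets of D (resp. G), compactness in the ambient space agrees with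
   compactness in the subspace topology. *)
Definition proper_map (X Y : topologicalType) (D : set X) (G : set Y)
    (f : X -> Y) : Prop :=
  forall K : set Y, K `<=` G -> compact K -> compact (D `&` f @^-1` K).

Definition finite_Blaschke (R : realType) (B : Cplx R -> Cplx R) : Prop :=
  exists (N : nat) (c : Cplx R) (a : 'I_N -> Cplx R),
    [/\ (1 <= N)%N, `|c| = 1, forall j, disc (a j) &
        forall z, disc z ->
          B z = c * \prod_(j < N) ((z - a j) / (1 - (a j)^* * z))].

(* Main.v *)
Require Import Defs.
From mathcomp Require Import all_boot all_order all_algebra.
From mathcomp Require Import all_classical all_reals all_analysis.
From mathcomp Require Import complex.
From mathcomp Require Import ring lra.
Set Implicit Arguments.
Unset Strict Implicit.
Unset Printing Implicit Defensive.
Import Order.TTheory GRing.Theory Num.Theory.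
Import numFieldNormedType.Exports.
Local Open Scope classical_set_scope.
Local Open Scope ring_scope.

(** For z in the polydisc let P_z be the monic polynomial of degree n whose roots
are the n points of the disc that [symmap] sends to f z; its coefficients are,
up to sign, the entries of f z.  Properness of f says that P_z has a root close
to the unit circle as soon as some coordinate of z is close to the circle.

Suppose f proper.  Fix c with |c| = 1.  The sum of (c + r) / (c - r) over the
roots r of P_z is a rational function of the coefficients of P_z, hence
holomorphic in z, and its real part is positive; it is large exactly when a
root is close to c.  Harnack's inequality therefore spreads roots close to c
from one point to a whole compact set ([family_near]): when the coordinate z_k
is close to the circle, all the P_z with this z_k and the other coordinates in
a compact set have a root close to one and the same c.  A resultant of two
combinations of such polynomials is a holomorphic function of z_k that tends to
0 at the circle, so it vanishes identically, and then, for every value zeta of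
z_k, all the P_z with z_k = zeta have a common root ([family_common]).

No point s is a root of all P_z: dividing by X - s would leave a family of
degree n - 1 with the same properties, and such a family needs degree at least
the number of variables ([family_degree_ge]), because by the identity theorem
the coordinates of a base point z can be chosen one after the other so that
common roots belonging to different coordinates are different
([disjoint_slice_roots]).  At such a base point the roots are n distinct
numbers b_k, one for each coordinate.  Moving only the k-th coordinate keeps
all b_j with j <> k, so the remaining root B_k is a holomorphic function of
that coordinate ([coord_rootE]); it is a proper self-map of the disc, hence a
finite Blaschke product ([proper_Blaschke]).  The identity theorem in one
variable shows that B_k (z_k) is a root of P_z for every z
([coord_root_global]) and that P_z is the product of the X - B_k (z_k)
([family_prod]).

Conversely, Blaschke products extend continuously to the closed disc and are
unimodular on the circle, so a limit of points of the preimage of a compact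
subset of the symmetrized polydisc stays in the open polydisc
([Blaschke_proper]).

The theory of one complex variable starts from differentiability at each point.
Contour integrals are replaced by midpoint sums over dyadic subdivisions: these
sums are exactly additive under subdivision and exact on affine functions, so
the bisection argument of Goursat applies to them ([goursat]).  In logarithmic
coordinates this compares the discrete means of a function on two concentric
circles ([circle_mean_radius]), and Cauchy's formula holds as a limit of such
means ([cauchy_formula]).  Maximum principle, removable singularities, Schwarz's
lemma, Harnack's inequality and the identity theorem follow. *)

(** * The complex field and its real-valued modulus *)

Section ComplexBasics.
Variable R : realType.
Local Notation C := (Cplx R).
Implicit Types (z w : C) (x y : R).

Definition cre (z : C) : R := complex.Re z.
Definition cim (z : C) : R := complex.Im z.
Definition mkC (x y : R) : C := (Complex x y).
Definition rc (x : R) : C := mkC x 0.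
(** The norm of [C] takes its values in [C] itself, where the order is partial; all
estimates are made with this copy in [R]. *)
Definition cabs (z : C) : R := complex.Re `|z|.

Lemma mkC_eta z : mkC (cre z) (cim z) = z.
Proof. by case: z. Qed.
Lemma cre_mk x y : cre (mkC x y) = x. Proof. by []. Qed.
Lemma cim_mk x y : cim (mkC x y) = y. Proof. by []. Qed.
Lemma cre_rc x : cre (rc x) = x. Proof. by []. Qed.
Lemma cim_rc x : cim (rc x) = 0. Proof. by []. Qed.
Lemma creD z w : cre (z + w) = cre z + cre w.
Proof. by case: z w => [? ?] [? ?]. Qed.
Lemma cimD z w : cim (z + w) = cim z + cim w.
Proof. by case: z w => [? ?] [? ?]. Qed.
Lemma creN z : cre (- z) = - cre z.
Proof. by case: z => [? ?]. Qed.
Lemma cimN z : cim (- z) = - cim z.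
Proof. by case: z => [? ?]. Qed.
Lemma creM z w : cre (z * w) = cre z * cre w - cim z * cim w.
Proof. by case: z w => [? ?] [? ?]. Qed.
Lemma cimM z w : cim (z * w) = cre z * cim w + cim z * cre w.
Proof. by case: z w => [? ?] [? ?]. Qed.
Lemma cre0 : cre 0 = 0. Proof. by []. Qed.
Lemma cim0 : cim 0 = 0. Proof. by []. Qed.
Lemma cre1 : cre 1 = 1. Proof. by []. Qed.
Lemma cim1 : cim 1 = 0. Proof. by []. Qed.
Lemma cre_conj z : cre (z^*) = cre z.
Proof. by case: z. Qed.
Lemma cim_conj z : cim (z^*) = - cim z.
Proof. by case: z. Qed.
Definition cE := (creD, cimD, creN, cimN, creM, cimM, cre_rc, cim_rc,
  cre_mk, cim_mk, cre0, cim0, cre1, cim1, cre_conj, cim_conj).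

Lemma complex_ext z w : cre z = cre w -> cim z = cim w -> z = w.
Proof. by case: z w => [? ?] [? ?]; rewrite /cre /cim /= => -> ->. Qed.

Lemma rc0 : rc 0 = 0. Proof. by []. Qed.
Lemma rc1 : rc 1 = 1. Proof. by []. Qed.
Lemma rcD x y : rc (x + y) = rc x + rc y.
Proof. by apply: complex_ext; rewrite !cE ?addr0. Qed.
Lemma rcN x : rc (- x) = - rc x.
Proof. by apply: complex_ext; rewrite !cE ?oppr0. Qed.
Lemma rcB x y : rc (x - y) = rc x - rc y.
Proof. by rewrite rcD rcN. Qed.
Lemma rcM x y : rc (x * y) = rc x * rc y.
Proof. by apply: complex_ext; rewrite !cE; ring. Qed.
Lemma rcI : injective rc.
Proof. by move=> x y /(congr1 cre). Qed.
Lemma rc_eq0 x : (rc x == 0) = (x == 0).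
Proof. by rewrite -rc0 (inj_eq rcI). Qed.
Lemma rcV x : rc (x^-1) = (rc x)^-1.
Proof.
have [->|x0] := eqVneq x 0; first by rewrite invr0 rc0 invr0.
have rx0 : rc x != 0 by rewrite rc_eq0.
by apply: (mulfI rx0); rewrite -rcM !divff.
Qed.
Lemma rcX x n : rc (x ^+ n) = rc x ^+ n.
Proof. by elim: n => [|n IH]; rewrite ?expr0 // !exprS rcM IH. Qed.
Lemma rc_nat n : rc n%:R = n%:R.
Proof. by elim: n => [|n IH] //; rewrite -addn1 !natrD rcD IH. Qed.

Lemma cabsE z : `|z| = rc (cabs z).
Proof. by rewrite /cabs /rc /mkC (normc_def (z:R[i])). Qed.
Lemma cabs_sqr z : cabs z ^+ 2 = cre z ^+2 + cim z ^+ 2.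
Proof.
by rewrite /cabs (normc_def (z:R[i])) /= sqr_sqrtr // addr_ge0 // sqr_ge0.
Qed.
Lemma rc_le x y : (rc x <= rc y) = (x <= y).
Proof. by rewrite (lecR x y). Qed.
Lemma rc_lt x y : (rc x < rc y) = (x < y).
Proof. by rewrite (ltcR x y). Qed.
Lemma cabs_ge0 z : 0 <= cabs z.
Proof. by rewrite -rc_le -cabsE rc0. Qed.
Lemma cabs0 : cabs 0 = 0. Proof. by rewrite /cabs normr0. Qed.
Lemma cabs1 : cabs 1 = 1. Proof. by rewrite /cabs normr1. Qed.
Lemma cabs_eq0 z : (cabs z == 0) = (z == 0).
Proof. by rewrite -rc_eq0 -cabsE normr_eq0. Qed.
Lemma cabs_gt0 z : (0 < cabs z) = (z != 0).
Proof. by rewrite -rc_lt -cabsE normr_gt0. Qed.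
Lemma cabsD z w : cabs (z + w) <= cabs z + cabs w.
Proof. by rewrite -rc_le rcD -!cabsE ler_normD. Qed.
Lemma cabsN z : cabs (- z) = cabs z.
Proof. by rewrite /cabs normrN. Qed.
Lemma cabsB z w : cabs (z - w) <= cabs z + cabs w.
Proof. by rewrite -(cabsN w) cabsD. Qed.
Lemma cabs_distC z w : cabs (z - w) = cabs (w - z).
Proof. by rewrite -cabsN opprB. Qed.
Lemma cabsM z w : cabs (z * w) = cabs z * cabs w.
Proof. by apply: rcI; rewrite rcM -!cabsE normrM. Qed.
Lemma cabsV z : cabs (z^-1) = (cabs z)^-1.
Proof. by apply: rcI; rewrite rcV -!cabsE normfV. Qed.
Lemma cabsX z n : cabs (z ^+ n) = cabs z ^+ n.
Proof. by apply: rcI; rewrite rcX -!cabsE normrX. Qed.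
Lemma cabs_rc x : cabs (rc x) = `|x|.
Proof.
apply/eqP; rewrite -(@eqrXn2 _ 2%N) ?cabs_ge0 //.
by rewrite cabs_sqr !cE expr0n addr0 real_normK // num_real.
Qed.
Lemma cabs_conj z : cabs (z^*) = cabs z.
Proof.
apply/eqP; rewrite -(@eqrXn2 _ 2%N) ?cabs_ge0 //.
by rewrite !cabs_sqr !cE sqrrN.
Qed.
Lemma cabs_prod (I : Type) (r : seq I) (P : pred I) (F : I -> C) :
  cabs (\prod_(i <- r | P i) F i) = \prod_(i <- r | P i) cabs (F i).
Proof. by apply: (big_morph _ cabsM); rewrite cabs1. Qed.
Lemma cabs_sum (I : Type) (r : seq I) (P : pred I) (F : I -> C) :
  cabs (\sum_(i <- r | P i) F i) <= \sum_(i <- r | P i) cabs (F i).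
Proof.
elim/big_rec2: _ => [|i y1 y2 Pi h]; first by rewrite cabs0.
by rewrite (le_trans (cabsD _ _)) // lerD2l.
Qed.
Lemma cre_le_cabs z : cre z <= cabs z.
Proof.
have [h|h] := lerP (cre z) 0; first exact: le_trans h (cabs_ge0 z).
rewrite -(@ler_pXn2r _ 2%N) ?nnegrE ?cabs_ge0 ?(ltW h) //.
by rewrite cabs_sqr lerDl sqr_ge0.
Qed.
Lemma abs_cre_le z : `|cre z| <= cabs z.
Proof.
by rewrite ler_norml cre_le_cabs andbT lerNl -cabsN -creN cre_le_cabs.
Qed.
Lemma abs_cim_le z : `|cim z| <= cabs z.
Proof.
have := abs_cre_le (z * mkC 0 1); rewrite !cE cabsM.
have -> : cabs (mkC 0 1) = 1.
  by apply/eqP; rewrite -(@eqrXn2 _ 2%N) ?cabs_ge0 // cabs_sqr !cE; apply/eqP; ring.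
by rewrite mulr0 mulr1 sub0r normrN mulr1.
Qed.
Lemma cabs_im y : cabs (mkC 0 y) = `|y|.
Proof.
apply/eqP; rewrite -(@eqrXn2 _ 2%N) ?cabs_ge0 //.
by rewrite cabs_sqr !cE expr0n add0r real_normK // num_real.
Qed.
Lemma cabs_mk x y : cabs (mkC x y) <= `|x| + `|y|.
Proof.
rewrite -(@ler_pXn2r _ 2%N) ?nnegrE ?cabs_ge0 ?addr_ge0 //.
rewrite cabs_sqr !cE sqrrD !real_normK ?num_real // -addrA lerD2l lerDr.
by rewrite mulrn_wge0 ?mulr_ge0.
Qed.
Lemma cabs_rev z w : cabs z - cabs w <= cabs (z - w).
Proof. by rewrite lerBlDr; rewrite -{1}(subrK w z) cabsD. Qed.

Lemma discE z : disc z = (cabs z < 1) :> Prop.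
Proof. by rewrite /disc /= cabsE -rc1 rc_lt. Qed.

Lemma mulC_conj z : z * z^* = rc (cabs z ^+ 2).
Proof. by apply: complex_ext; rewrite cabs_sqr !cE; ring. Qed.

Lemma nbhs_cabsP z (P : set C) :
  nbhs z P <-> exists2 e : R, 0 < e & forall w, cabs (w - z) < e -> P w.
Proof.
split=> [/nbhs_ballP[e /= e0 h]|[e e0 h]].
  have re : e = rc (cre e).
    have : 0 <= e by exact: ltW.
    by move/(@ger0_Im R e) => im; apply: complex_ext; rewrite ?cE.
  exists (cre e); first by rewrite -rc_lt -re rc0.
  by move=> w zw; apply: h; rewrite /ball /= distrC cabsE re rc_lt.
apply/nbhs_ballP; exists (rc e); first by rewrite /= -rc0 rc_lt.
by move=> w; rewrite /ball /= distrC cabsE rc_lt => /h.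
Qed.

Lemma cvg_cabsP (T : Type) (F : set_system T) (FF : Filter F) (f : T -> C) (l : C) :
  f @ F --> l <-> forall e : R, 0 < e -> \forall x \near F, cabs (f x - l) < e.
Proof.
split=> [h e e0|h].
  apply: (h [set w | cabs (w - l) < e]).
  by apply/nbhs_cabsP; exists e.
by move=> A /nbhs_cabsP[e /h{}h e0]; apply: filterS h => x; exact: e0.
Qed.

Lemma cont_cabsP (f : C -> C) z : {for z, continuous f} <->
  forall e : R, 0 < e -> exists2 d : R, 0 < d &
    forall w, cabs (w - z) < d -> cabs (f w - f z) < e.
Proof.
split=> [/(cvg_cabsP (nbhs_filter z)) h e /h /nbhs_cabsP //|h].
by apply/(cvg_cabsP (nbhs_filter z)) => e /h ?; apply/nbhs_cabsP.
Qed.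

(** Linear approximation with real epsilons: the form in which complex
differentiability enters the estimates. *)
Lemma differentiable_approx (f : C -> C) z : differentiable f z ->
  exists d : C, forall e : R, 0 < e -> exists2 r : R, 0 < r &
    forall w, cabs (w - z) < r -> cabs (f w - f z - d * (w - z)) <= e * cabs (w - z).
Proof.
move=> /diff_derivable - /(_ 1) /derivable_nbhsP.
set d := 'D_1 f z => h; exists d => e e0.
move/eqaddoP : h => /(_ (rc e)); rewrite -{1}rc0 rc_lt => /(_ e0) /nbhs_cabsP[r r0 h].
exists r => // w wz; have := h (w - z).
rewrite subr0 => /(_ wz) /=; rewrite !fctE /=.
rewrite !cabsE -rcM rc_le; congr (cabs _ <= _).
rewrite -[(w-z) *: 1]/((w - z) * 1) mulr1 subrK.
by rewrite -[(w-z) *: d]/((w - z) * d); ring.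
Qed.

Lemma approx_differentiable (f : C -> C) z (d : C) :
  (forall e : R, 0 < e -> exists2 r : R, 0 < r &
    forall w, cabs (w - z) < r -> cabs (f w - f z - d * (w - z)) <= e * cabs (w - z)) ->
  differentiable f z.
Proof.
move=> h; apply/derivable1_diffP; apply/cvg_ex => /=; exists d.
apply/cvg_cabsP => e e0.
have e20 : 0 < e / 2 by lra.
have [r r0 {}h] := h _ e20.
apply/nbhs_cabsP; exists r => // w; rewrite subr0 => wr w0.
have := h (w + z); rewrite addrK => /(_ wr).
rewrite -[w%:A]/(w * 1) mulr1 -[_ *: _]/(w^-1 * _) => H.
have -> : w^-1 * (f (w + z) - f z) - d = w^-1 * (f (w + z) - f z - d * w) by field.
have cw : 0 < cabs w by rewrite cabs_gt0.
rewrite cabsM cabsV mulrC ltr_pdivrMr //.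
apply: (le_lt_trans H); rewrite ltr_pM2r //; lra.
Qed.

(** Closure rules stated for functions written pointwise, so that they unify with
abstractions such as [fun w => f w * g w]. *)
Section DiffRules.
Variables (V : normedModType C) (f g : V -> C) (x : V).
Lemma dfcst (c : C) : differentiable (fun _ : V => c) x.
Proof. exact: differentiable_cst. Qed.
Lemma dfD : differentiable f x -> differentiable g x ->
  differentiable (fun w : V => f w + g w) x.
Proof. exact: differentiableD. Qed.
Lemma dfN : differentiable f x -> differentiable (fun w : V => - f w) x.
Proof. exact: differentiableN. Qed.
Lemma dfB : differentiable f x -> differentiable g x ->
  differentiable (fun w : V => f w - g w) x.
Proof. exact: differentiableB. Qed.
Lemma dfM : differentiable f x -> differentiable g x ->
  differentiable (fun w : V => f w * g w) x.
Proof. exact: differentiableM. Qed.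
Lemma dfV : differentiable f x -> f x != 0 -> differentiable (fun w : V => (f w)^-1) x.
Proof. exact: differentiableV. Qed.
End DiffRules.
Lemma dfid z : differentiable (fun w : C => w) z.
Proof. by apply: ex_diff. Qed.

Lemma small_expr x (e : R) : 0 <= x < 1 -> 0 < e -> exists n, x ^+ n < e.
Proof.
move=> /andP[x0 x1] e0.
have /cvg_expr/cvgrPdist_lt/(_ _ e0) : `|x| < 1 by rewrite ger0_norm.
case=> n _ /(_ n (leqnn n)); rewrite sub0r normrN ger0_norm ?exprn_ge0 // => h.
by exists n.
Qed.

End ComplexBasics.

(** * Midpoint contour sums and the theorem of Goursat *)

Section Goursat.
Variable R : realType.
Local Notation C := (Cplx R).

(** The mean of the values at the midpoints of the [2 ^ K] equal parts of
[[s, s + l]].  Recursion on the halves makes the compatibility with bisection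
definitional. *)
Fixpoint midmean (K : nat) (phi : R -> C) (s l : R) : C :=
  if K is K'.+1 then (midmean K' phi s (l / 2) + midmean K' phi (s + l / 2) (l / 2)) / 2
  else phi (s + l / 2).

Lemma midmean_le K phi s l (M : R) : 0 <= l ->
  (forall t, s <= t <= s + l -> cabs (phi t) <= M) -> cabs (midmean K phi s l) <= M.
Proof.
elim: K s l => [|K IH] s l l0 h /=; first by apply: h; lra.
rewrite cabsM cabsV -(rc_nat R 2) cabs_rc ger0_norm // ler_pdivrMr //.
apply: (le_trans (cabsD _ _)); have -> : M * 2 = M + M by ring.
by apply: lerD; apply: IH => [|t ht]; (try apply: h); lra.
Qed.

Lemma eq_midmean K phi psi s l : 0 <= l ->
  (forall t, s <= t <= s + l -> phi t = psi t) -> midmean K phi s l = midmean K psi s l.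
Proof.
elim: K s l => [|K IH] s l l0 h /=; first by apply: h; lra.
by congr ((_ + _) / _); apply: IH => [|t ht]; (try apply: h); lra.
Qed.

Lemma midmeanD K phi psi s l :
  midmean K (fun t => phi t + psi t) s l = midmean K phi s l + midmean K psi s l.
Proof. by elim: K s l => [|K IH] s l //=; rewrite !IH; field. Qed.

Lemma midmeanZ K c phi s l :
  midmean K (fun t => c * phi t) s l = c * midmean K phi s l.
Proof. by elim: K s l => [|K IH] s l //=; rewrite !IH; field. Qed.

Lemma midmeanB K phi psi s l :
  midmean K (fun t => phi t - psi t) s l = midmean K phi s l - midmean K psi s l.
Proof. by elim: K s l => [|K IH] s l //=; rewrite !IH; field. Qed.

(** The midpoint rule is exact on affine functions. *)
Lemma midmean_affine K (a b : C) s l :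
  midmean K (fun t => a + rc t * b) s l = a + rc (s + l / 2) * b.
Proof.
elim: K s l => [|K IH] s l //=; rewrite !IH.
have -> : s + l / 2 / 2 = (s + l / 2) - (l / 2 / 2) by field.
by rewrite (rcD (s + l/2)) rcN (rcD (s + l/2)); field.
Qed.

Lemma midmean_cst K (a : C) s l : midmean K (fun=> a) s l = a.
Proof. by elim: K s l => [|K IH] s l //=; rewrite !IH; field. Qed.

(** Midpoint sum for the integral of [h dz] along the positively oriented boundary
of the rectangle with lower left corner (x, y) and sides a and b. *)
Definition rect_sum (K : nat) (h : C -> C) (x y a b : R) : C :=
  rc a * (midmean K (fun t => h (mkC t y)) x a - midmean K (fun t => h (mkC t (y + b))) x a) +
  mkC 0 b * (midmean K (fun t => h (mkC (x + a) t)) y b - midmean K (fun t => h (mkC x t)) y b).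

(** The contributions of the inner edges cancel exactly, because the two rectangles
that share an edge evaluate [h] at the same midpoints. *)
Lemma rect_sum_split K h x y a b : rect_sum K.+1 h x y a b =
  rect_sum K h x y (a / 2) (b / 2) + rect_sum K h (x + a / 2) y (a / 2) (b / 2) +
  (rect_sum K h x (y + b / 2) (a / 2) (b / 2) +
   rect_sum K h (x + a / 2) (y + b / 2) (a / 2) (b / 2)).
Proof.
rewrite /rect_sum /=.
have -> : x + a / 2 + a / 2 = x + a by field.
have -> : y + b / 2 + b / 2 = y + b by field.
have -> : rc a = 2 * rc (a / 2) by rewrite -(rc_nat R 2) -rcM; congr rc; field.
have -> : mkC 0 b = 2 * mkC 0 (b / 2).
  by rewrite -(rc_nat R 2); apply: complex_ext; rewrite !cE; field.
by field.
Qed.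

Lemma rect_sum_le K h x y a b (M : R) : 0 <= a -> 0 <= b ->
  (forall u v, x <= u <= x + a -> y <= v <= y + b -> cabs (h (mkC u v)) <= M) ->
  cabs (rect_sum K h x y a b) <= 2 * (a + b) * M.
Proof.
move=> a0 b0 hM.
have cb : cabs (mkC 0 b) <= b.
  by apply: (le_trans (cabs_mk _ _)); rewrite normr0 add0r ger0_norm.
have B1 : cabs (midmean K (fun t => h (mkC t y)) x a) <= M.
  by apply: midmean_le => // t ht; apply: hM; lra.
have B2 : cabs (midmean K (fun t => h (mkC t (y + b))) x a) <= M.
  by apply: midmean_le => // t ht; apply: hM; lra.
have B3 : cabs (midmean K (fun t => h (mkC (x + a) t)) y b) <= M.
  by apply: midmean_le => // t ht; apply: hM; lra.
have B4 : cabs (midmean K (fun t => h (mkC x t)) y b) <= M.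
  by apply: midmean_le => // t ht; apply: hM; lra.
apply: (le_trans (cabsD _ _)); rewrite !cabsM cabs_rc ger0_norm //.
have := cabsB (midmean K (fun t => h (mkC t y)) x a) (midmean K (fun t => h (mkC t (y + b))) x a).
have := cabsB (midmean K (fun t => h (mkC (x + a) t)) y b) (midmean K (fun t => h (mkC x t)) y b).
set u := cabs (_ - _); set v := cabs (_ - _) => uM vM.
have -> : 2 * (a + b) * M = a * (M + M) + b * (M + M) by ring.
apply: lerD; first by apply: ler_wpM2l => //; lra.
apply: ler_pM => //; rewrite ?cabs_ge0 //; lra.
Qed.

Lemma rect_sumB K h g x y a b :
  rect_sum K (fun z => h z - g z) x y a b = rect_sum K h x y a b - rect_sum K g x y a b.
Proof. by rewrite /rect_sum !midmeanB; ring. Qed.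

Lemma rect_sum_affine K (c d : C) x y a b : rect_sum K (fun z => c + d * z) x y a b = 0.
Proof.
have E1 s l v : midmean K (fun t => c + d * mkC t v) s l = (c + mkC 0 v * d) + rc (s + l / 2) * d.
  rewrite -(midmean_affine K); congr (midmean K _ s l); apply: funext => t.
  by apply: complex_ext; rewrite !cE; ring.
have E2 s l v : midmean K (fun t => c + d * mkC v t) s l = (c + rc v * d) + rc (s + l / 2) * (mkC 0 1 * d).
  rewrite -(midmean_affine K); congr (midmean K _ s l); apply: funext => t.
  by apply: complex_ext; rewrite !cE; ring.
by rewrite /rect_sum !E1 !E2; apply: complex_ext; rewrite !cE; ring.
Qed.


Definition rect_sum_large (h : C -> C) (e x y a b : R) : Prop :=
  forall K0, exists2 K, (K0 <= K)%N & e < cabs (rect_sum K h x y a b).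

Lemma rect_sum_largeN h e x y a b : ~ rect_sum_large h e x y a b ->
  exists K0, forall K, (K0 <= K)%N -> cabs (rect_sum K h x y a b) <= e.
Proof.
move=> /existsNP[K0 hK0]; exists K0 => K hK; rewrite leNgt; apply/negP => hc.
by apply: hK0; exists K.
Qed.

Lemma rect_sum_large_split h e x y a b : rect_sum_large h e x y a b ->
  exists i j : bool,
    rect_sum_large h (e / 4) (x + a / 2 * i%:R) (y + b / 2 * j%:R) (a / 2) (b / 2).
Proof.
move=> hbad; apply: contrapT => /forallNP no.
have good (i j : bool) := rect_sum_largeN ((forallNP _).2 (no i) j).
have [K1 h1] := good false false; have [K2 h2] := good true false.
have [K3 h3] := good false true; have [K4 h4] := good true true.
have [[|K] hK] := hbad (maxn (maxn K1 K2) (maxn K3 K4)).+1 => //.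
move: hK; rewrite ltnS !geq_max => /andP[/andP[/h1 + /h2 +] /andP[/h3 + /h4 +]].
rewrite rect_sum_split /= !mulr0 !mulr1 !addr0.
set u1 := rect_sum _ _ _ _ _ _; set u2 := rect_sum _ _ _ _ _ _.
set u3 := rect_sum _ _ _ _ _ _; set u4 := rect_sum _ _ _ _ _ _.
have := cabsD (u1 + u2) (u3 + u4); have := cabsD u1 u2; have := cabsD u3 u4.
lra.
Qed.

(** Bisection.  If the sums stay above [e] for arbitrarily large [K], then so do
those of one of the four quarters above [e / 4]: this gives nested rectangles
that shrink to a point.  There [h] is affine up to an error that is small
compared with the diameter, the affine part contributes nothing, and the sum is
small compared with the area, a contradiction. *)
Lemma goursat h x y a b : 0 < a -> 0 < b ->
  (forall u v, x <= u <= x + a -> y <= v <= y + b -> differentiable h (mkC u v)) ->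
  forall e, 0 < e -> exists K0, forall K, (K0 <= K)%N -> cabs (rect_sum K h x y a b) <= e.
Proof.
move=> a0 b0 hdiff e e0; apply: rect_sum_largeN => bad0.
pose dn (n : nat) (c : R) := c / 2 ^+ n.
have dnS n c : dn n c / 2 = dn n.+1 c.
  by rewrite /dn exprS invfM mulrA mulrAC.
have dn_gt0 n c : 0 < c -> 0 < dn n c by move=> c0; rewrite divr_gt0 ?exprn_gt0.
pose bad (p : nat * (R * R)) :=
  rect_sum_large h (e / 4 ^+ p.1) p.2.1 p.2.2 (dn p.1 a) (dn p.1 b).
pose T := {p : nat * (R * R) | bad p}.
pose rel (p q : T) := [/\ (sval q).1 = (sval p).1.+1,
  exists i : bool, (sval q).2.1 = (sval p).2.1 + dn (sval q).1 a * i%:R &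
  exists i : bool, (sval q).2.2 = (sval p).2.2 + dn (sval q).1 b * i%:R].
have step (p : T) : {q : T | rel p q}.
  apply: cid; case: p => -[n [u v]] /= hp.
  have [i [j hq]] := rect_sum_large_split hp.
  have hb : bad (n.+1, (u + dn n.+1 a * i%:R, v + dn n.+1 b * j%:R)).
    rewrite /bad /=; move: hq; rewrite /= !dnS.
    by congr (rect_sum_large _ _ _ _ _ _); rewrite exprSr invfM mulrA.
  by exists (exist _ _ hb); split => //=; [exists i | exists j].
have b0' : bad (0%N, (x, y)) by rewrite /bad /dn /= !expr0 !divr1.
have [s [s0 hs]] := dependent_choice step (exist _ _ b0').
have s1 n : (sval (s n)).1 = n.
  by elim: n => [|n IH]; [rewrite s0 | have [-> _ _] := hs n; rewrite IH].
pose X n := (sval (s n)).2.1; pose Y n := (sval (s n)).2.2.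
have Xs n : exists i : bool, X n.+1 = X n + dn n.+1 a * i%:R.
  by have [] := hs n; rewrite s1.
have Ys n : exists i : bool, Y n.+1 = Y n + dn n.+1 b * i%:R.
  by have [] := hs n; rewrite s1.
have lim (Z : nat -> R) (c : R) : 0 < c ->
    (forall n, exists i : bool, Z n.+1 = Z n + dn n.+1 c * i%:R) ->
    exists z, forall n, Z n <= z <= Z n + dn n c.
  move=> c0 hZ.
  have mono n m : Z n <= Z (n + m)%N /\ Z (n + m)%N + dn (n + m)%N c <= Z n + dn n c.
    elim: m => [|m [IH1 IH2]]; first by rewrite addn0.
    rewrite addnS; have [i ->] := hZ (n + m)%N.
    have := dn_gt0 (n + m).+1 c c0.
    have : dn (n + m)%N c = 2 * dn (n + m).+1 c by rewrite -dnS; field.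
    by case: i; rewrite ?mulr0 ?mulr1; lra.
  have bnd n m : Z m <= Z n + dn n c.
    have [nm|/ltnW nm] := leqP n m.
      have [_] := mono n (m - n)%N; rewrite subnKC //.
      by have := dn_gt0 m c c0; lra.
    have [+ _] := mono m (n - m)%N; rewrite subnKC //.
    by have := dn_gt0 n c c0; lra.
  have hsup : has_sup (range Z).
    split; first by exists (Z 0%N), 0%N.
    by exists (Z 0%N + dn 0%N c) => _ [m _ <-]; exact: bnd.
  exists (sup (range Z)) => n; apply/andP; split.
    by apply: sup_upper_bound => //; exists n.
  by apply: ge_sup; [exists (Z 0%N), 0%N | move=> _ [m _ <-]; exact: bnd].
have [zx hzx] := lim X a a0 Xs; have [zy hzy] := lim Y b b0 Ys.
have X0 : X 0%N = x by rewrite /X s0.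
have Y0 : Y 0%N = y by rewrite /Y s0.
have d0 c : dn 0 c = c by rewrite /dn expr0 divr1.
have := hdiff zx zy; have := hzx 0%N; have := hzy 0%N.
rewrite X0 Y0 !d0 => -> -> /(_ isT isT) /differentiable_approx[d hd].
(* Relative precision of the affine approximation that leads to [e / 4 ^+ n], as the
   sum over a rectangle of perimeter [2 * d] and diameter at most [d] is bounded by
   [2 * d * (eta * d)]. *)
pose eta := e / (2 * (a + b) * (a + b)).
have eta0 : 0 < eta by rewrite /eta divr_gt0 // !mulr_gt0 // addr_gt0.
have [r r0 hr] := hd _ eta0.
have [n hn] : exists n, dn n (a + b) < r.
  have ab0 : 0 < a + b by rewrite addr_gt0.
  have [||n hn] := @small_expr R (2^-1) (r / (a + b)); first lra.
    by rewrite divr_gt0.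
  by exists n; rewrite /dn -exprVn mulrC -ltr_pdivlMr.
have abn : dn n a + dn n b = dn n (a + b) by rewrite /dn -mulrDl.
have badn : rect_sum_large h (e / 4 ^+ n) (X n) (Y n) (dn n a) (dn n b).
  by have := svalP (s n); rewrite /bad s1.
have [K _] := badn 0%N; apply/negP; rewrite -leNgt.
pose c0 := h (mkC zx zy) - d * mkC zx zy.
have -> : rect_sum K h (X n) (Y n) (dn n a) (dn n b) =
          rect_sum K (fun z => h z - (c0 + d * z)) (X n) (Y n) (dn n a) (dn n b).
  by rewrite (rect_sumB K h (fun z => c0 + d * z)) rect_sum_affine subr0.
have an0 := dn_gt0 n a a0; have bn0 := dn_gt0 n b b0.
have -> : e / 4 ^+ n = 2 * (dn n a + dn n b) * (eta * dn n (a + b)).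
  have -> : 4 = 2 * 2 :> R by ring.
  rewrite abn /eta /dn exprMn; field.
  by rewrite expf_neq0 //=; apply/lt0r_neq0; rewrite addr_gt0.
apply: rect_sum_le => [||u v hu hv]; try exact: ltW.
have dist : cabs (mkC u v - mkC zx zy) <= dn n (a + b).
  have -> : mkC u v - mkC zx zy = mkC (u - zx) (v - zy).
    by apply: complex_ext; rewrite !cE.
  apply: (le_trans (cabs_mk _ _)); rewrite -abn.
  have := hzx n; have := hzy n => h1 h2.
  by apply: lerD; rewrite ler_norml; lra.
have := hr (mkC u v) (le_lt_trans dist hn).
rewrite /c0.
have -> : h (mkC u v) - (h (mkC zx zy) - d * mkC zx zy + d * mkC u v) =
  h (mkC u v) - h (mkC zx zy) - d * (mkC u v - mkC zx zy) by ring.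
move=> /le_trans; apply; rewrite ler_pM2l //.
Qed.

End Goursat.

(** * Discrete means over circles *)

Section CircleMeans.
Variable R : realType.
Local Notation C := (Cplx R).
Implicit Types (z w p : C) (F G : C -> C).

Lemma is_derive_approx (f : R -> R) (x d : R) : is_derive x 1 f d ->
  forall e, 0 < e -> exists2 r : R, 0 < r &
    forall h, `|h| < r -> `|f (x + h) - f x - d * h| <= e * `|h|.
Proof.
move=> [fx <-] e e0; have /derivable_nbhsP/eqaddoP/(_ e e0) := fx.
move=> /nbhs_ballP[r r0 H]; exists r => // h hr.
have := H h; rewrite /ball /= sub0r normrN => /(_ hr); rewrite !fctE.
by rewrite -[h *: 1]/(h * 1) mulr1 -[h *: _]/(h * _) (mulrC h) (addrC h) opprD addrA.
Qed.

Definition cexp (w : C) : C :=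
  mkC (expR (cre w) * cos (cim w)) (expR (cre w) * sin (cim w)).

Lemma cexpD z w : cexp (z + w) = cexp z * cexp w.
Proof. by apply: complex_ext; rewrite !cE ?expRD ?cosD ?sinD; ring. Qed.

Lemma cabs_cexp w : cabs (cexp w) = expR (cre w).
Proof.
apply/eqP; rewrite -(@eqrXn2 _ 2%N) ?cabs_ge0 ?expR_ge0 //.
rewrite cabs_sqr !cE; set c := cos _; set s := sin _.
have h : c ^+ 2 + s ^+ 2 = 1 by rewrite cos2Dsin2.
by rewrite !exprMn -mulrDr h mulr1.
Qed.

(** By multiplicativity it suffices to expand the exponential at 0, where the real
expansions of exp, cos and sin apply. *)
Lemma differentiable_cexp w : differentiable cexp w.
Proof.
apply: (@approx_differentiable _ _ _ (cexp w)) => e e0.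
have E0 : 0 < expR (cre w) by exact: expR_gt0.
have [eta [eta0 eta1 etae]] : exists eta : R, [/\ 0 < eta, eta <= 1 &
    eta <= e / expR (cre w) / 8].
  exists (Num.min 1 (e / expR (cre w) / 8)).
  by split; rewrite ?lt_min ?ltr01 ?ge_min ?lexx ?orbT //= !divr_gt0.
have [r1 r10 h1] := is_derive_approx (is_derive_expR 0) eta0.
have [r2 r20 h2] := is_derive_approx (is_derive_cos 0) eta0.
have [r3 r30 h3] := is_derive_approx (is_derive_sin 0) eta0.
exists (Num.min eta (Num.min r1 (Num.min r2 r3))).
  by rewrite !lt_min eta0 r10 r20.
move=> w'; have [z ->] : exists z, w' = w + z by exists (w' - w); ring.
have -> : w + z - w = z by ring.
rewrite !lt_min => /and4P[z0 z1 z2 z3].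
have ax := abs_cre_le z; have ay := abs_cim_le z.
move: {h1}(h1 _ (le_lt_trans ax z1)) {h2}(h2 _ (le_lt_trans ay z2))
  {h3}(h3 _ (le_lt_trans ay z3)).
rewrite !add0r expR0 cos0 sin0 mul1r oppr0 mul0r !subr0 mul1r addr0.
rewrite cexpD.
have -> : cexp w * cexp z - cexp w - cexp w * z = cexp w * (cexp z - 1 - z) by ring.
rewrite cabsM cabs_cexp; set x := cre z; set y := cim z => hE hc hs.
suff key : cabs (cexp z - 1 - z) <= 8 * eta * cabs z.
  apply: (@le_trans _ _ (expR (cre w) * (8 * eta * cabs z))); first by rewrite ler_pM2l.
  rewrite mulrA ler_wpM2r ?cabs_ge0 // mulrC -ler_pdivlMr //; lra.
have -> : cexp z - 1 - z = mkC ((expR x - 1 - x) * cos y + (1 + x) * (cos y - 1))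
      ((expR x - 1) * sin y + (sin y - y)).
  by apply: complex_ext; rewrite !cE /x /y; ring.
rewrite -/x in ax; rewrite -/y in ay; clearbody x y; have az0 := cabs_ge0 z.
have x1 : `|x| <= eta by apply: le_trans ax (ltW z0).
have cy : `|cos y| <= 1 by rewrite ler_norml cos_geN1 cos_le1.
have hx0 := normr_ge0 x; have hy0 := normr_ge0 y.
have ea : forall t, 0 <= t -> t <= cabs z -> eta * t <= eta * cabs z.
  by move=> t t0 tz; rewrite ler_pM2l.
have eb : forall t, 0 <= t -> t <= eta -> t * cabs z <= eta * cabs z.
  by move=> t t0 tz; rewrite ler_wpM2r.
have T1 : `|(expR x - 1 - x) * cos y| <= eta * cabs z.
  rewrite normrM; apply: (@le_trans _ _ (`|expR x - 1 - x| * 1)); first by rewrite ler_wpM2l.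
  by rewrite mulr1; apply: le_trans hE (ea _ hx0 ax).
have T2 : `|(1 + x) * (cos y - 1)| <= 2 * (eta * cabs z).
  rewrite normrM; apply: ler_pM => //; last exact: le_trans hc (ea _ hy0 ay).
  have := ler_normD 1 x; rewrite normr1; lra.
have E1 : `|expR x - 1| <= 2 * eta.
  have -> : expR x - 1 = (expR x - 1 - x) + x by ring.
  have := ler_normD (expR x - 1 - x) x; have := ler_pM (ltW eta0) hx0 (lexx eta) (le_trans x1 eta1).
  lra.
have S1 : `|sin y| <= 2 * cabs z.
  have -> : sin y = (sin y - y) + y by ring.
  have := ler_normD (sin y - y) y; have := ler_pM (ltW eta0) hy0 eta1 ay; lra.
have T3 : `|(expR x - 1) * sin y| <= 4 * (eta * cabs z).
  rewrite normrM.
  have -> : 4 * (eta * cabs z) = (2 * eta) * (2 * cabs z) by ring.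
  by apply: ler_pM.
have T4 : `|sin y - y| <= eta * cabs z by apply: le_trans hs (ea _ hy0 ay).
apply: (le_trans (cabs_mk _ _)).
have := ler_normD ((expR x - 1 - x) * cos y) ((1 + x) * (cos y - 1)).
have := ler_normD ((expR x - 1) * sin y) (sin y - y).
lra.
Qed.

Definition cis (t : R) : C := mkC (cos t) (sin t).
Lemma cabs_cis t : cabs (cis t) = 1.
Proof.
apply/eqP; rewrite -(@eqrXn2 _ 2%N) ?cabs_ge0 //.
by rewrite cabs_sqr !cE cos2Dsin2 expr1n.
Qed.
Lemma cabs_rcis r t : 0 <= r -> cabs (rc r * cis t) = r.
Proof. by move=> r0; rewrite cabsM cabs_rc cabs_cis mulr1 ger0_norm. Qed.
Lemma cexp_cis x t : cexp (mkC x t) = rc (expR x) * cis t.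
Proof. by apply: complex_ext; rewrite !cE; ring. Qed.

(** Two sequences with difference tending to 0: circle means are compared with each
other in this way before any of them is known to converge. *)
Definition same_limit (u v : nat -> C) : Prop := forall e : R, 0 < e ->
  exists K0, forall K, (K0 <= K)%N -> cabs (u K - v K) <= e.

Lemma same_limit_refl u : same_limit u u.
Proof. by move=> e e0; exists 0%N => K _; rewrite subrr cabs0 ltW. Qed.
Lemma same_limit_sym u v : same_limit u v -> same_limit v u.
Proof. by move=> h e /h[K0 hK]; exists K0 => K /hK; rewrite cabs_distC. Qed.
Lemma same_limit_trans v u (w : nat -> C) : same_limit u v -> same_limit v w -> same_limit u w.
Proof.
move=> h1 h2 e e0; have e2 : 0 < e / 2 by lra.
have [K1 k1] := h1 _ e2; have [K2 k2] := h2 _ e2.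
exists (maxn K1 K2) => K; rewrite geq_max => /andP[/k1 a /k2 b].
have -> : u K - w K = (u K - v K) + (v K - w K) by ring.
have := cabsD (u K - v K) (v K - w K); lra.
Qed.
Lemma same_limitD u v u' v' : same_limit u v -> same_limit u' v' ->
  same_limit (fun K => u K + u' K) (fun K => v K + v' K).
Proof.
move=> h1 h2 e e0; have e2 : 0 < e / 2 by lra.
have [K1 k1] := h1 _ e2; have [K2 k2] := h2 _ e2.
exists (maxn K1 K2) => K; rewrite geq_max => /andP[/k1 a /k2 b].
have -> : u K + u' K - (v K + v' K) = (u K - v K) + (u' K - v' K) by ring.
have := cabsD (u K - v K) (u' K - v' K); lra.
Qed.
Lemma same_limitZ c u v : same_limit u v -> same_limit (fun K => c * u K) (fun K => c * v K).
Proof.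
move=> h e e0; have c0 := cabs_ge0 c.
have [|K0 k0] := h (e / (cabs c + 1)); first by rewrite divr_gt0 //; lra.
exists K0 => K /k0 hK; rewrite -mulrBr cabsM.
apply: (@le_trans _ _ ((cabs c + 1) * (e / (cabs c + 1)))).
  by apply: ler_pM => //; rewrite ?cabs_ge0 //; lra.
by rewrite mulrC divfK //; lra.
Qed.
Lemma same_limit_conj u v : same_limit u v -> same_limit (fun K => (u K)^*) (fun K => (v K)^*).
Proof.
move=> h e /h[K0 k0]; exists K0 => K /k0.
by rewrite -rmorphB cabs_conj.
Qed.
Lemma same_limit_le u (l : C) (M : R) : same_limit u (fun=> l) ->
  (forall K, cabs (u K) <= M) -> cabs l <= M.
Proof.
move=> h hM; apply/ler_addgt0Pr => e /h[K0 /(_ K0 (leqnn _))].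
rewrite cabs_distC => hK; have := cabs_rev l (u K0); have := hM K0; lra.
Qed.

(** Mean over the [2 ^ K] midpoints on the circle of radius [r] about 0. *)
Definition circle_mean (F : C -> C) (r : R) (K : nat) : C :=
  midmean K (fun t => F (rc r * cis t)) 0 (2 * pi).

Let pi2 : (0 : R) <= 2 * pi. Proof. by rewrite mulr_ge0 // pi_ge0. Qed.

Lemma circle_mean_le F r (M : R) K : 0 <= r ->
  (forall z, cabs z = r -> cabs (F z) <= M) -> cabs (circle_mean F r K) <= M.
Proof. by move=> r0 h; apply: midmean_le => // t _; apply: h; rewrite cabs_rcis. Qed.
Lemma eq_circle_mean F G r : 0 <= r ->
  (forall z, cabs z = r -> F z = G z) -> circle_mean F r = circle_mean G r.
Proof.
move=> r0 h; apply/funext => K; apply: eq_midmean => // t _.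
by apply: h; rewrite cabs_rcis.
Qed.
Lemma circle_meanD F G r K : circle_mean (fun z => F z + G z) r K = circle_mean F r K + circle_mean G r K.
Proof. exact: midmeanD. Qed.
Lemma circle_meanB F G r K : circle_mean (fun z => F z - G z) r K = circle_mean F r K - circle_mean G r K.
Proof. exact: midmeanB. Qed.
Lemma circle_meanZ c F r K : circle_mean (fun z => c * F z) r K = c * circle_mean F r K.
Proof. exact: midmeanZ. Qed.
Lemma circle_mean_cst c r K : circle_mean (fun=> c) r K = c.
Proof. exact: midmean_cst. Qed.
Lemma circle_mean_conj F r K : circle_mean (fun z => (F z)^*) r K = (circle_mean F r K)^*.
Proof.
rewrite /circle_mean; move: 0 (2 * pi); elim: K => [|K IH] s l //=.
rewrite !IH [in RHS]rmorphM rmorphD fmorphV; congr (_ / _).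
by rewrite rmorph_nat.
Qed.

(** Apply [goursat] to [F \o cexp] on a rectangle of height [2 * pi].  By periodicity
the two horizontal sides cancel exactly, and the vertical sides are the two
circle means. *)
Lemma circle_mean_radius F (s t : R) : 0 < s -> s <= t ->
  (forall z, s <= cabs z <= t -> differentiable F z) -> same_limit (circle_mean F s) (circle_mean F t).
Proof.
move=> s0; rewrite le_eqVlt => /orP[/eqP<- _|st hF]; first exact: same_limit_refl.
have t0 : 0 < t by exact: lt_trans st.
have a0 : 0 < ln t - ln s by rewrite subr_gt0 ltr_ln ?posrE.
have p0 : 0 < 2 * pi :> R by rewrite mulr_gt0 // pi_gt0.
apply: same_limit_sym => e e0.
have [||K0 hK] := @goursat R (F \o cexp) (ln s) 0 _ _ a0 p0 _ (2 * pi * e).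
- move=> u v /andP[u1 u2] _; apply: differentiable_comp; first exact: differentiable_cexp.
  apply: hF; rewrite cabs_cexp cre_mk -{1}(@lnK R s) ?posrE // -{1}(@lnK R t) ?posrE //.
  by rewrite !ler_expR; lra.
- by rewrite mulr_gt0.
exists K0 => K /hK; rewrite /rect_sum.
have -> : (fun t0 => (F \o cexp) (mkC t0 (0 + 2 * pi))) = (fun t0 => (F \o cexp) (mkC t0 0)).
  apply/funext => u /=; congr (F _); rewrite !cexp_cis; congr (_ * _).
  by rewrite /cis add0r mulr_natl cos2pi sin2pi cos0 sin0.
rewrite subrr mulr0 add0r.
have E x : 0 < x -> midmean K (fun t0 => (F \o cexp) (mkC (ln x) t0)) 0 (2 * pi) = circle_mean F x K.
  move=> x0; rewrite /circle_mean; congr (midmean K _ _ _); apply/funext => u /=.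
  by rewrite cexp_cis lnK ?posrE.
have -> : ln s + (ln t - ln s) = ln t by ring.
rewrite !E // cabsM.
rewrite cabs_im ger0_norm //.
by rewrite ler_pM2l.
Qed.

End CircleMeans.

(** * The mean value property *)

Section Cauchy.
Variable R : realType.
Local Notation C := (Cplx R).
Implicit Types (z w p : C) (F G f g : C -> C).

Lemma diff_cont F z : differentiable F z -> {for z, continuous F}.
Proof. exact: differentiable_continuous. Qed.

(** Uniformly in [K], since [F] is uniformly continuous near the circle by
compactness of [[0, 2 * pi]]. *)
Lemma circle_mean_continuous F (rho : R) : 0 < rho ->
  (forall z, cabs z = rho -> {for z, continuous F}) ->
  forall e : R, 0 < e -> exists2 d : R, 0 < d &
    forall l, `|l - 1| < d -> forall K, cabs (circle_mean F (l * rho) K - circle_mean F rho K) <= e.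
Proof.
move=> r0 hF e e0.
pose P (l t : R) := cabs (F (rc (l * rho) * cis t) - F (rc rho * cis t)) <= e.
have /compact_near_coveringP/(_ R (nbhs (1:R)) P _) := @segment_compact R 0 (2 * pi).
case=> [t0 _|d /= d0 hd].
  have z0E : cabs (rc rho * cis t0) = rho by rewrite cabs_rcis // ltW.
  have [d d0 hd] := (cont_cabsP _ _).1 (hF _ z0E) (e / 2) (divr_gt0 e0 (ltr0n _ 2)).
  have h0 : 0 < d / rho / 4 by rewrite !divr_gt0.
  have := @continuous_cos R t0 => /cvgrPdist_lt/(_ _ h0) hc.
  have := @continuous_sin R t0 => /cvgrPdist_lt/(_ _ h0) hs.
  exists ([set t | `|cos t0 - cos t| < d / rho / 4 /\ `|sin t0 - sin t| < d / rho / 4],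
          [set l | `|1 - l| < d / rho / 4]).
    split; first by near=> t; split; near: t.
    exact: (nbhsx_ballx (1:R) _ h0).
  move=> [t l] /= [[c1 s1] l1]; rewrite /P.
  have near1 m : `|1 - m| < d / rho / 4 -> cabs (F (rc (m * rho) * cis t) - F (rc rho * cis t0)) < e / 2.
    move=> m1; apply: hd.
    have -> : rc (m * rho) * cis t - rc rho * cis t0 =
      rc rho * (rc (m - 1) * cis t + mkC (cos t - cos t0) (sin t - sin t0)).
      by apply: complex_ext; rewrite !cE; ring.
    rewrite cabsM cabs_rc gtr0_norm // mulrC -ltr_pdivlMr //.
    apply: (le_lt_trans (cabsD _ _)); rewrite cabsM cabs_cis mulr1 cabs_rc.
    have := cabs_mk (cos t - cos t0) (sin t - sin t0).
    rewrite distrC in c1; rewrite distrC in s1; rewrite distrC in m1; lra.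
  have l2 : `|1 - 1| < d / rho / 4 by rewrite subrr normr0.
  have := near1 _ l1; have := near1 _ l2; rewrite mul1r.
  set a := F (rc (l * rho) * cis t); set b := F (rc rho * cis t).
  set c := F (rc rho * cis t0).
  have := cabsB (a - c) (b - c).
  have -> : a - c - (b - c) = a - b by ring.
  lra.
exists d => // l hl K.
rewrite /circle_mean -midmeanB; apply: midmean_le => [|t]; first by rewrite mulr_ge0 // pi_ge0.
by rewrite add0r => ht; apply: hd => //=; rewrite ?in_itv //= distrC.
Unshelve. all: by end_near. Qed.

(** The means agree on both sides of the circle through the exceptional point [p];
continuity in the radius bridges the gap. *)
Lemma circle_mean_cross F p (s t : R) : 0 < s -> s < cabs p < t ->
  (forall z, s <= cabs z <= t -> z != p -> differentiable F z) ->
  {for p, continuous F} -> same_limit (circle_mean F s) (circle_mean F t).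
Proof.
move=> s0 /andP[sp pt] hF hp e e0; have [rho rhoE] : exists rho, rho = cabs p by exists (cabs p).
rewrite -rhoE in sp pt.
have r0 : 0 < rho by exact: lt_trans sp.
have e4 : 0 < e / 4 by lra.
have [|d d0 hd] := @circle_mean_continuous F rho r0 _ _ e4.
  move=> z zr; have [->//|zp] := eqVneq z p.
  by apply/diff_cont/hF => //; rewrite zr; lra.
have [l [l0 ld ls lt]] : exists l : R, [/\ 0 < l, l < d, s <= (1 - l) * rho & (1 + l) * rho <= t].
  exists (Num.min (d / 2) (Num.min (1 - s / rho) (t / rho - 1))).
  have h1 : 0 < 1 - s / rho by rewrite subr_gt0 ltr_pdivrMr // mul1r.
  have h2 : 0 < t / rho - 1 by rewrite subr_gt0 ltr_pdivlMr // mul1r.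
  have d2 : 0 < d / 2 by lra.
  split; first by rewrite !lt_min d2 h1 h2.
  - by rewrite !gt_min; apply/orP; left; lra.
  - rewrite -ler_pdivrMr // lerBrDl -lerBrDr.
    by rewrite !ge_min lexx orbT.
  - rewrite -ler_pdivlMr // -lerBrDl.
    by rewrite !ge_min lexx !orbT.
have lr : 0 < l * rho by exact: mulr_gt0.
have [|K1 k1] := @circle_mean_radius R F s ((1 - l) * rho) s0 ls _ _ e4.
  move=> z /andP[z1 z2]; apply: hF; first by lra.
  by apply: contraTneq z2 => ->; rewrite -ltNge -rhoE; lra.
have r2 : 0 < (1 + l) * rho by lra.
have [|K2 k2] := @circle_mean_radius R F ((1 + l) * rho) t r2 lt _ _ e4.
  move=> z /andP[z1 z2]; apply: hF; first by lra.
  by apply: contraTneq z1 => ->; rewrite -ltNge -rhoE; lra.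
exists (maxn K1 K2) => K; rewrite geq_max => /andP[/k1 a /k2 b].
have c1 : `|(1 - l) - 1| < d.
  have -> : 1 - l - 1 = - l by ring.
  by rewrite normrN gtr0_norm.
have c2 : `|(1 + l) - 1| < d.
  have -> : 1 + l - 1 = l by ring.
  by rewrite gtr0_norm.
have := hd _ c1 K; have := hd _ c2 K.
move: a b; set u1 := circle_mean F s K; set u2 := circle_mean F ((1 - l) * rho) K; set u3 := circle_mean F rho K.
set u4 := circle_mean F ((1 + l) * rho) K; set u5 := circle_mean F t K.
have -> : u1 - u5 = (u1 - u2) + (u2 - u3) - (u4 - u3) + (u4 - u5) by ring.
have := cabsD ((u1 - u2) + (u2 - u3) - (u4 - u3)) (u4 - u5).
have := cabsB ((u1 - u2) + (u2 - u3)) (u4 - u3).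
have := cabsD (u1 - u2) (u2 - u3).
lra.
Qed.

(** The exceptional point [p], where [F] is only continuous, is what Cauchy's
formula needs: there [F] is a difference quotient at [p]. *)
Lemma mean_value F p (r : R) : 0 < r -> cabs p < r ->
  (forall z, cabs z <= r -> z != 0 -> z != p -> differentiable F z) ->
  {for 0, continuous F} -> {for p, continuous F} ->
  same_limit (circle_mean F r) (fun=> F 0).
Proof.
move=> r0 pr hF h0 hp e e0; have e2 : 0 < e / 2 by lra.
have [d d0 hd] := (cont_cabsP _ _).1 h0 (e / 2) e2.
have [s [s0 sd sr sp]] : exists s : R, [/\ 0 < s, s < d, s < r & p != 0 -> s < cabs p].
  exists (Num.min (d / 2) (Num.min (r / 2) (if p == 0 then 1 else cabs p / 2))).
  split.
  - rewrite !lt_min; apply/and3P; split; [lra|lra|].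
    by case: eqP => // /eqP; rewrite -cabs_gt0; lra.
  - by rewrite !gt_min; apply/orP; left; lra.
  - by rewrite !gt_min; apply/orP; right; apply/orP; left; lra.
  - move=> p0; rewrite (negbTE p0) !gt_min; apply/orP; right; apply/orP; right.
    by move: p0; rewrite -cabs_gt0; lra.
have zs z : s <= cabs z -> z != 0 by rewrite -cabs_gt0; lra.
have : same_limit (circle_mean F s) (circle_mean F r).
  have [p0|p0] := eqVneq p 0.
    apply: (circle_mean_radius s0 (ltW sr)).
    by move=> z /andP[/zs z0 zr]; apply: (hF _ zr z0); rewrite p0.
  apply: (@circle_mean_cross F p _ _ s0 _ _ hp); first by rewrite sp.
  by move=> z /andP[/zs z0 zr]; exact: hF _ zr z0.
move=> /same_limit_sym/(_ _ e2)[K0 k0]; exists K0 => K /k0 h1.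
have h2 : cabs (circle_mean F s K - F 0) <= e / 2.
  rewrite -{1}(circle_mean_cst (F 0) s K) -circle_meanB; apply: circle_mean_le; first exact: ltW.
  by move=> z zE; apply/ltW/hd; rewrite subr0 zE.
have -> : circle_mean F r K - F 0 = (circle_mean F r K - circle_mean F s K) + (circle_mean F s K - F 0) by ring.
have := cabsD (circle_mean F r K - circle_mean F s K) (circle_mean F s K - F 0); lra.
Qed.

(** On the circle [z / (z - p)] is the conjugate of a function that is holomorphic
inside, with value 1 at 0. *)
Lemma circle_mean_kernel p (r : R) : cabs p < r -> same_limit (circle_mean (fun z => z / (z - p)) r) (fun=> 1).
Proof.
move=> pr; have r0 : 0 < r by exact: le_lt_trans (cabs_ge0 p) pr.
have rr : rc (r ^+ 2) != 0 by rewrite rc_eq0 expf_neq0 // lt0r_neq0.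
pose G z := (1 - p^* * z / rc (r ^+ 2))^-1.
have nz z : cabs z <= r -> 1 - p^* * z / rc (r ^+ 2) != 0.
  move=> zr; rewrite subr_eq0; apply/eqP => /(congr1 (@cabs R)).
  rewrite cabs1 !cabsM cabsV cabs_rc cabs_conj gtr0_norm ?exprn_gt0 // => /eqP.
  rewrite eq_sym -(inj_eq (mulIf (lt0r_neq0 (exprn_gt0 2 r0)))) mul1r divfK ?lt0r_neq0 ?exprn_gt0 //.
  move/eqP; apply/eqP; rewrite lt_eqF // expr2.
  by apply: (@le_lt_trans _ _ (cabs p * r)); rewrite ?ler_wpM2l ?cabs_ge0 ?ltr_pM2r.
have Gd z : cabs z <= r -> differentiable G z.
  move=> zr; apply: dfV; last exact: nz.
  apply: dfB; first exact: dfcst.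
  by apply: dfM; [apply: dfM; [exact: dfcst|exact: dfid]|exact: dfcst].
have -> : circle_mean (fun z => z / (z - p)) r = circle_mean (fun z => (G z)^*) r.
  apply: eq_circle_mean => [|z zr]; first exact: ltW.
  have z0 : z != 0 by rewrite -cabs_gt0 zr.
  have E : (1 - p^* * z / rc (r ^+ 2))^* = (z - p) / z.
    have -> : (1 - p^* * z / rc (r ^+ 2))^* = 1 - p * z^* / (z * z^*).
      by rewrite mulC_conj zr; apply: complex_ext; rewrite -rcV !cE; ring.
    by field; rewrite z0 fmorph_eq0.
  have -> : (G z)^* = ((1 - p^* * z / rc (r ^+ 2))^*)^-1 by exact: fmorphV.
  by rewrite E invf_div.
apply: (@same_limit_trans _ (fun K => (circle_mean G r K)^*)).
  by move=> e e0; exists 0%N => K _; rewrite circle_mean_conj subrr cabs0 ltW.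
have -> : (fun=> 1 : C) = (fun=> (G 0)^*) :> (nat -> C).
  by apply/funext => _; rewrite /G mulr0 mul0r subr0 invr1 rmorph1.
apply: same_limit_conj; apply: (@mean_value G 0 r r0); first by rewrite cabs0.
- by move=> z zr _ _; exact: Gd.
- by apply/diff_cont/Gd; rewrite cabs0 ltW.
- by apply/diff_cont/Gd; rewrite cabs0 ltW.
Qed.

End Cauchy.

(** * Cauchy's formula and the maximum principle *)

Section MaxPrinciple.
Variable R : realType.
Local Notation C := (Cplx R).
Implicit Types (z w p : C) (F G f g : C -> C).

Lemma diff_near F G z (e : R) : 0 < e ->
  (forall w, cabs (w - z) < e -> F w = G w) ->
  differentiable F z -> differentiable G z.
Proof.
move=> e0 FG /differentiable_approx[d hd]; apply: (@approx_differentiable _ _ _ d) => e' /hd[r r0 hr].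
exists (Num.min r e) => [|w]; first by rewrite lt_min r0.
rewrite lt_min => /andP[wr we]; rewrite -!FG ?subrr ?cabs0 //.
exact: hr.
Qed.

Lemma cont_near F G z (e : R) : 0 < e ->
  (forall w, cabs (w - z) < e -> F w = G w) ->
  {for z, continuous F} -> {for z, continuous G}.
Proof.
move=> e0 FG /cont_cabsP h; apply/cont_cabsP => e' /h[r r0 hr].
exists (Num.min r e) => [|w]; first by rewrite lt_min r0.
rewrite lt_min => /andP[wr we]; rewrite -!FG ?subrr ?cabs0 //.
exact: hr.
Qed.

Lemma contM F G z : {for z, continuous F} -> {for z, continuous G} ->
  {for z, continuous (fun w => F w * G w)}.
Proof. by move=> h1 h2; exact: (cvgM h1 h2). Qed.

Lemma contB F G z : {for z, continuous F} -> {for z, continuous G} ->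
  {for z, continuous (fun w => F w - G w)}.
Proof. by move=> h1 h2; exact: (cvgB h1 h2). Qed.
Lemma contV F z : {for z, continuous F} -> F z != 0 ->
  {for z, continuous (fun w => (F w)^-1)}.
Proof. by move=> h1 h2; exact: (cvgV h2 h1). Qed.
Lemma cont_cst (c : C) z : {for z, continuous (fun _ : C => c)}.
Proof. by apply/cont_cabsP => e e0; exists 1 => // w _; rewrite subrr cabs0. Qed.
Lemma cont_idC z : {for z, continuous (fun w : C => w)}.
Proof. by apply/cont_cabsP => e e0; exists e. Qed.

Lemma slope_continuous f p : differentiable f p -> exists h : C -> C,
  {for p, continuous h} /\ forall z, f z - f p = h z * (z - p).
Proof.
move=> /differentiable_approx[d hd].
exists (fun z => if z == p then d else (f z - f p) / (z - p)); split; last first.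
  move=> z; have [->|zp] := eqVneq z p; first by rewrite !subrr mulr0.
  by rewrite divfK // subr_eq0.
apply/cont_cabsP => e e0; have e2 : 0 < e / 2 by lra.
have [r r0 hr] := hd _ e2; exists r => // w wr; rewrite eqxx.
case: (eqVneq w p) => [_|wp]; first by rewrite subrr cabs0.
have wp0 : w - p != 0 by rewrite subr_eq0.
have -> : (f w - f p) / (w - p) - d = (f w - f p - d * (w - p)) / (w - p) by field.
rewrite cabsM cabsV ltr_pdivrMr ?cabs_gt0 //.
apply: (le_lt_trans (hr w wr)); rewrite ltr_pM2r ?cabs_gt0 //; lra.
Qed.

Lemma slope_differentiable f p h z : (forall z, f z - f p = h z * (z - p)) ->
  z != p -> differentiable f z -> differentiable h z.
Proof.
move=> hE zp fz; have zp0 : 0 < cabs (z - p) by rewrite cabs_gt0 subr_eq0.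
apply: (@diff_near (fun w => (f w - f p) / (w - p)) _ _ (cabs (z - p)) zp0).
  move=> w wz; rewrite hE mulfK // subr_eq0; apply: contraTneq wz => ->.
  by rewrite cabs_distC ltxx.
apply: dfM; first by apply: dfB; [exact: fz|exact: dfcst].
apply: dfV; last by rewrite subr_eq0.
by apply: dfB; [exact: dfid|exact: dfcst].
Qed.

(** Apply [mean_value] to [z * (f z - f p) / (z - p)], which vanishes at 0.  The
point 0 is allowed to be a singularity of [f], for use in [removable]. *)
Lemma cauchy_formula f p (r : R) : cabs p < r -> {for 0, continuous f} ->
  (forall z, cabs z <= r -> z != 0 -> differentiable f z) ->
  same_limit (circle_mean (fun z => f z * (z / (z - p))) r) (fun=> f p).
Proof.
move=> pr f0 fd; have r0 : 0 < r by exact: le_lt_trans (cabs_ge0 p) pr.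
have rz z : cabs z = r -> z != 0 by move=> zr; rewrite -cabs_gt0 zr.
have [p0|p0] := eqVneq p 0.
  have -> : circle_mean (fun z => f z * (z / (z - p))) r = circle_mean f r.
    by apply: eq_circle_mean; [exact: ltW|move=> z /rz z0; rewrite p0 subr0 divff // mulr1].
  rewrite p0; apply: (@mean_value _ f 0 r r0).
  - by rewrite cabs0.
  - by move=> z zr z0 _; exact: fd.
  - exact: f0.
  - exact: f0.
have [h [hc hE]] := slope_continuous (fd _ (ltW pr) p0).
have h0 : {for 0, continuous h}.
  have p1 : 0 < cabs p by rewrite cabs_gt0.
  apply: (@cont_near (fun w => (f w - f p) / (w - p)) _ _ (cabs p) p1).
    move=> w; rewrite subr0 => wp; rewrite hE mulfK // subr_eq0.
    by apply: contraTneq wp => ->; rewrite ltxx.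
  apply: contM; first by apply: contB; [exact: f0 | exact: cont_cst].
  apply: contV; last by rewrite sub0r oppr_eq0.
  by apply: contB; [exact: cont_idC | exact: cont_cst].
have -> : circle_mean (fun z => f z * (z / (z - p))) r =
    (fun K => circle_mean (fun z => h z * z) r K + f p * circle_mean (fun z => z / (z - p)) r K).
  apply/funext => K; rewrite -circle_meanZ -circle_meanD; congr (_ K); apply: eq_circle_mean => [|z zr].
    exact: ltW.
  have zp : z - p != 0.
    by rewrite subr_eq0; apply: contraTneq pr => <-; rewrite zr ltxx.
  have -> : f z = h z * (z - p) + f p by rewrite -hE; ring.
  by field.
have -> : (fun=> f p) = (fun=> (h 0 * 0) + f p * 1) :> (nat -> C).
  by apply/funext => _; ring.
apply: same_limitD; last by apply/same_limitZ/circle_mean_kernel.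
apply: (@mean_value _ (fun z => h z * z) p r r0 pr).
- move=> z zr z0 zp; apply: dfM; last exact: dfid.
  by apply: (slope_differentiable hE zp); exact: fd.
- by apply: contM; [exact: h0 | exact: cont_idC].
- by apply: contM; [exact: hc | exact: cont_idC].
Qed.

Definition hol f := forall z, disc z -> differentiable f z.

Lemma hol_cst (c : C) : hol (fun=> c). Proof. by move=> z _; exact: dfcst. Qed.
Lemma hol_id : hol (fun z => z). Proof. by move=> z _; exact: dfid. Qed.
Lemma holD f g : hol f -> hol g -> hol (fun z => f z + g z).
Proof. by move=> hf hg z dz; apply: dfD; [exact: hf|exact: hg]. Qed.
Lemma holN f : hol f -> hol (fun z => - f z).
Proof. by move=> hf z dz; apply: dfN; exact: hf. Qed.
Lemma holB f g : hol f -> hol g -> hol (fun z => f z - g z).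
Proof. by move=> hf hg z dz; apply: dfB; [exact: hf|exact: hg]. Qed.
Lemma holM f g : hol f -> hol g -> hol (fun z => f z * g z).
Proof. by move=> hf hg z dz; apply: dfM; [exact: hf|exact: hg]. Qed.
Lemma holV f : hol f -> (forall z, disc z -> f z != 0) -> hol (fun z => (f z)^-1).
Proof. by move=> hf h0 z dz; apply: dfV; [exact: hf|exact: h0]. Qed.
Lemma holX f n : hol f -> hol (fun z => f z ^+ n).
Proof.
move=> hf; elim: n => [|n IH]; first by apply: hol_cst.
have -> : (fun z => f z ^+ n.+1) = (fun z => f z * f z ^+ n).
  by apply/funext => z; rewrite exprS.
exact: holM.
Qed.
Lemma hol_sum (I : Type) (r : seq I) (P : pred I) (F : I -> C -> C) :
  (forall i, P i -> hol (F i)) -> hol (fun z => \sum_(i <- r | P i) F i z).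
Proof.
move=> h; elim: r => [|i r IH].
  rewrite (_ : (fun z => _) = (fun=> 0)); first exact: hol_cst.
  by apply/funext => z; rewrite big_nil.
rewrite (_ : (fun z => _) = (fun z => (if P i then F i z else 0) + \sum_(j <- r | P j) F j z)).
  by apply: holD IH; case Pi: (P i); [exact: h|exact: hol_cst].
by apply/funext => z; rewrite big_cons; case: ifP; rewrite ?add0r.
Qed.
Lemma hol_prod (I : Type) (r : seq I) (P : pred I) (F : I -> C -> C) :
  (forall i, P i -> hol (F i)) -> hol (fun z => \prod_(i <- r | P i) F i z).
Proof.
move=> h; elim: r => [|i r IH].
  rewrite (_ : (fun z => _) = (fun=> 1)); first exact: hol_cst.
  by apply/funext => z; rewrite big_nil.
rewrite (_ : (fun z => _) = (fun z => (if P i then F i z else 1) * \prod_(j <- r | P j) F j z)).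
  by apply: holM IH; case Pi: (P i); [exact: h|exact: hol_cst].
by apply/funext => z; rewrite big_cons; case: ifP; rewrite ?mul1r.
Qed.
Lemma hol_comp f g : hol f -> hol g -> (forall z, disc z -> disc (g z)) ->
  hol (fun z => f (g z)).
Proof.
move=> hf hg gd z dz; apply: (@differentiable_comp _ _ _ _ g f); first exact: hg.
exact/hf/gd.
Qed.

Lemma discP z : reflect (disc z) (cabs z < 1).
Proof. by rewrite (discE z); exact: idP. Qed.
Lemma disc0 : disc (0 : C). Proof. by apply/discP; rewrite cabs0. Qed.
Hint Resolve disc0 : core.

Lemma between (x y : R) : x < y -> exists2 t, x < t & t < y.
Proof. by move=> xy; exists ((x + y) / 2); lra. Qed.

(** Cauchy's formula bounds [f p] by a constant times the bound on the circle.
Applied to the powers of [f], it makes the constant disappear. *)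
Lemma max_circle f p (r M : R) : cabs p < r -> r < 1 -> hol f ->
  (forall z, cabs z = r -> cabs (f z) <= M) -> cabs (f p) <= M.
Proof.
move=> pr r1 hf hM; have r0 : 0 < r by exact: le_lt_trans (cabs_ge0 p) pr.
have M0 : 0 <= M.
  apply: le_trans (hM (rc r) _); rewrite ?cabs_ge0 // cabs_rc gtr0_norm //.
rewrite leNgt; apply/negP => Mf; have f0 := le_lt_trans M0 Mf.
have pow k : cabs (f p) ^+ k <= M ^+ k * (r / (r - cabs p)).
  rewrite -cabsX.
  have /same_limit_le : same_limit (circle_mean (fun z => f z ^+ k * (z / (z - p))) r) (fun=> f p ^+ k).
    apply: (@cauchy_formula (fun z => f z ^+ k)) => //.
      by apply/diff_cont/(holX k hf).
    by move=> z zr _; apply: (holX k hf); apply/discP; exact: le_lt_trans zr r1.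
  apply => K; apply: circle_mean_le => [|z zr]; first exact: ltW.
  rewrite !cabsM cabsV cabsX zr; apply: ler_pM => //.
  - by rewrite exprn_ge0 // cabs_ge0.
  - by rewrite mulr_ge0 ?invr_ge0 ?cabs_ge0 // ltW.
  - by apply: lerXn2r; rewrite ?nnegrE ?cabs_ge0 // hM.
  - rewrite ler_pM2l // lef_pV2 ?posrE ?subr_gt0 //.
      by have := cabs_rev z p; rewrite zr.
    by have := cabs_rev z p; rewrite zr; lra.
have c0 : 0 < r / (r - cabs p) by rewrite divr_gt0 // subr_gt0.
have [||k hk] := @small_expr R (M / cabs (f p)) (r / (r - cabs p))^-1.
- by rewrite divr_ge0 ?cabs_ge0 //= ltr_pdivrMr // mul1r.
- by rewrite invr_gt0.
have := pow k; rewrite leNgt => /negP; apply.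
move: hk; rewrite expr_div_n ltr_pdivrMr ?exprn_gt0 // mulrC.
by rewrite ltr_pdivlMr.
Qed.

Lemma max_principle f (M : R) : hol f ->
  (forall e : R, 0 < e -> exists2 r : R, r < 1 &
     forall z, r < cabs z -> cabs z < 1 -> cabs (f z) <= M + e) ->
  forall p, disc p -> cabs (f p) <= M.
Proof.
move=> hf hM p /discP p1; apply/ler_addgt0Pr => e /hM[r r1 hr].
have [|s] := @between (Num.max r (cabs p)) 1; first by rewrite gt_max r1.
rewrite gt_max => /andP[rs ps] s1.
by apply: (max_circle ps s1 hf) => z zs; apply: hr; rewrite zs.
Qed.

(** [u t + L * t] is nondecreasing, so its infimum is the limit at 0. *)
Lemma lipschitz_limit (u : R -> R) (L d : R) : 0 <= L -> 0 < d ->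
  (forall s t, 0 < s < d -> 0 < t < d -> `|u s - u t| <= L * `|s - t|) ->
  exists a, forall t, 0 < t < d -> `|u t - a| <= L * t.
Proof.
move=> L0 d0 hu; pose A := [set u t + L * t | t in [set t | 0 < t < d]].
have lo s t : 0 < s < d -> 0 < t < d -> u t - L * t <= u s + L * s.
  move=> hs ht; have := hu s t hs ht; rewrite ler_norml => /andP[h _].
  have : L * `|s - t| <= L * (s + t).
    by rewrite ler_wpM2l // ler_norml; lra.
  lra.
have hA : has_inf A.
  split; first by exists (u (d / 2) + L * (d / 2)), (d / 2) => //=; lra.
  exists (u (d / 2) - L * (d / 2)) => _ [s /= hs <-]; apply: lo => //; lra.
exists (inf A) => t ht; rewrite ler_norml; apply/andP; split.
  have : inf A <= u t + L * t by apply: ge_inf; [case: hA|exists t].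
  lra.
have : u t - L * t <= inf A.
  by apply: lb_le_inf; [case: hA | move=> _ [s /= hs <-]; exact: lo].
lra.
Qed.

Lemma cabs_continuous : continuous (@cabs R).
Proof.
move=> z; apply/(@cvgrPdist_lt _ _ _ _ (nbhs_filter z)) => e e0; apply/nbhs_cabsP; exists e => // w wz.
apply: le_lt_trans wz; rewrite ler_norml; apply/andP; split.
  by have := cabs_rev w z; lra.
by rewrite cabs_distC cabs_rev.
Qed.

Lemma compact_cdisc (r : R) : compact [set z : C | cabs z <= r].
Proof.
have mk_cont : continuous (fun xy : R * R => mkC xy.1 xy.2).
  move=> [x y]; apply/(cvg_cabsP (nbhs_filter (x, y))) => e e0.
  have e2 : 0 < e / 2 by lra.
  exists (ball x (e / 2), ball y (e / 2)); first by split; exact: nbhsx_ballx.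
  move=> [x' y'] /= []; rewrite /ball /= => hx hy.
  have -> : mkC x' y' - mkC x y = mkC (x' - x) (y' - y) by apply: complex_ext; rewrite !cE.
  by apply: le_lt_trans (cabs_mk _ _) _; rewrite distrC (distrC y'); lra.
apply: (@subclosed_compact _ _ ((fun xy : R * R => mkC xy.1 xy.2) @` (`[-r, r] `*` `[-r, r]))).
- rewrite (_ : mkset _ = (@cabs R) @^-1` [set x | x <= r]); last by [].
  by apply: closed_comp => [z _|]; [exact: cabs_continuous | exact: closed_le].
- apply: continuous_compact; first exact: continuous_subspaceT.
  by apply: compact_setX; exact: segment_compact.
- move=> z zr; exists (cre z, cim z); last by rewrite mkC_eta.
  by split => /=; rewrite in_itv /= -ler_norml; apply: le_trans zr; [exact: abs_cre_le|exact: abs_cim_le].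
Qed.

Lemma cont_bounded f (r : R) : (forall z, cabs z <= r -> {for z, continuous f}) ->
  exists M, forall z, cabs z <= r -> cabs (f z) <= M.
Proof.
move=> hf.
have /compact_near_coveringP/(_ nat \oo (fun n z => cabs (f z) <= n%:R) _) := @compact_cdisc r.
case=> [z zr|N _ /(_ N (leqnn N)) h]; last by exists N%:R => z /h.
have [d d0 hd] := (cont_cabsP _ _).1 (hf z zr) 1 ltr01.
have [N hN] : exists N : nat, cabs (f z) + 1 <= N%:R.
  exists (Num.bound (cabs (f z) + 1)); apply/ltW/archi_boundP.
  by rewrite addr_ge0 ?cabs_ge0.
exists ([set w | cabs (w - z) < d], [set n | (N <= n)%N]).
  by split; [apply/nbhs_cabsP; exists d|exists N].
move=> [w n] /= [/hd wz Nn]; have := cabs_rev (f w) (f z).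
have : N%:R <= n%:R :> R by rewrite ler_nat.
lra.
Qed.

End MaxPrinciple.

(** * Removable singularities, Schwarz and Harnack *)

Section Removable.
Variable R : realType.
Local Notation C := (Cplx R).
Implicit Types (z w p : C) (F G f g : C -> C).

Lemma same_limitB (u v u' v' : nat -> C) : same_limit u v -> same_limit u' v' ->
  same_limit (fun K => u K - u' K) (fun K => v K - v' K).
Proof.
move=> h1 h2; have := same_limitD h1 (same_limitZ (-1) h2).
by under eq_fun do rewrite mulN1r; under [in X in same_limit _ X -> _]eq_fun do rewrite mulN1r.
Qed.

(** By [cauchy_formula] the difference quotients of [f] at 0 are limits of the means
of [f z / (z - h)], hence Lipschitz in [h], so they converge at 0. *)
Lemma removable f : {for 0, continuous f} ->
  (forall z, disc z -> z != 0 -> differentiable f z) -> differentiable f 0.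
Proof.
move=> f0 fd; have dz (z : C) : cabs z <= 1 / 2 -> disc z.
  by move=> h; apply/discP; apply: le_lt_trans h _; lra.
have fc z : cabs z <= 1 / 2 -> {for z, continuous f}.
  move=> /dz zd; have [->|z0] := eqVneq z 0; first exact: f0.
  exact/diff_cont/fd.
have [M hM] := cont_bounded fc.
have M0 : 0 <= M.
  by apply: le_trans (hM 0 _); rewrite ?cabs_ge0 // cabs0; lra.
have hr : (0 : R) < 1 / 2 by lra.
(* The difference quotient at 0, to be shown Lipschitz. *)
pose q h := h^-1 * (f h - f 0).
have cauchy h : cabs h < 1 / 4 -> same_limit (circle_mean (fun z => f z * (z / (z - h))) (1/2)) (fun=> f h).
  move=> hh; apply: cauchy_formula; [lra|exact: f0|].
  by move=> z /dz zd z0; exact: fd.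
have lip h h' : h != 0 -> h' != 0 -> cabs h < 1 / 4 -> cabs h' < 1 / 4 ->
    cabs (q h - q h') <= 16 * M * cabs (h - h').
  move=> h0 h'0 hh hh'.
  have a0 : cabs (0 : C) < 1 / 4 by rewrite cabs0; lra.
  have A k (kk : cabs k < 1 / 4) := same_limitZ (k^-1) (same_limitB (cauchy k kk) (cauchy 0 a0)).
  have /same_limit_le := same_limitB (A h hh) (A h' hh'); apply => K.
  rewrite -!circle_meanB -!circle_meanZ -circle_meanB; apply: circle_mean_le => [|z zr]; first exact: ltW.
  have n0 k : cabs k < 1 / 4 -> z - k != 0.
    by move=> kk; rewrite -cabs_gt0; have := cabs_rev z k; lra.
  have -> : h^-1 * (f z * (z / (z - h)) - f z * (z / (z - 0))) -
     h'^-1 * (f z * (z / (z - h')) - f z * (z / (z - 0))) =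
     f z * ((h - h') * ((z - h)^-1 * (z - h')^-1)).
    by have := n0 0 a0; have := n0 h hh; have := n0 h' hh'; rewrite subr0 => ? ? ?; field; do !(apply/andP; split).
  have bk k : cabs k < 1 / 4 -> cabs (z - k)^-1 <= 4.
    move=> kk; have := cabs_rev z k => hzk; rewrite cabsV -[4]invrK.
    by rewrite lef_pV2 ?posrE ?invr_gt0 //; lra.
  have -> : 16 * M * cabs (h - h') = M * (cabs (h - h') * (4 * 4)) by ring.
  rewrite !cabsM; apply: ler_pM; rewrite ?mulr_ge0 ?cabs_ge0 //.
    by apply: hM; rewrite zr.
  apply: ler_wpM2l; first exact: cabs_ge0.
  by apply: ler_pM; rewrite ?cabs_ge0 ?bk.
have rcq (t : R) : 0 < t < 1 / 4 -> rc t != 0 /\ cabs (rc t) < 1 / 4.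
  by move=> /andP[t0 t4]; rewrite rc_eq0 lt0r_neq0 // cabs_rc gtr0_norm.
have L0 : 0 <= 16 * M by lra.
have r4 : (0 : R) < 1 / 4 by lra.
have lipr s t : 0 < s < 1 / 4 -> 0 < t < 1 / 4 ->
    cabs (q (rc s) - q (rc t)) <= 16 * M * `|s - t|.
  move=> /rcq[s0 s4] /rcq[t0 t4].
  by have := lip _ _ s0 t0 s4 t4; rewrite -rcB cabs_rc.
have [a ha] : exists a, forall t, 0 < t < 1 / 4 -> `|cre (q (rc t)) - a| <= 16 * M * t.
  apply: lipschitz_limit => // s t hs ht; apply: le_trans (lipr s t hs ht).
  by rewrite -creN -creD abs_cre_le.
have [b hb] : exists b, forall t, 0 < t < 1 / 4 -> `|cim (q (rc t)) - b| <= 16 * M * t.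
  apply: lipschitz_limit => // s t hs ht; apply: le_trans (lipr s t hs ht).
  by rewrite -cimN -cimD abs_cim_le.
apply: (@approx_differentiable _ _ _ (mkC a b)) => e e0.
have M1 : 0 < 64 * M + 1 by lra.
exists (Num.min (1 / 4) (e / (64 * M + 1))).
  by rewrite lt_min r4 divr_gt0.
move=> w; rewrite subr0 lt_min => /andP[w4 we].
have [->|w0] := eqVneq w 0; first by rewrite subrr mulr0 subrr cabs0 mulr0.
have -> : f w - f 0 - mkC a b * w = (q w - mkC a b) * w by rewrite /q; field.
rewrite cabsM ler_wpM2r ?cabs_ge0 //.
have t0 : 0 < cabs w < 1 / 4 by rewrite cabs_gt0 w0.
have [u0 u4] := rcq _ t0.
have h1 := lip _ _ w0 u0 w4 u4.
have h2 : cabs (w - rc (cabs w)) <= 2 * cabs w.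
  have := cabsB w (rc (cabs w)); rewrite cabs_rc ger0_norm ?cabs_ge0 //; lra.
have h3 : cabs (q (rc (cabs w)) - mkC a b) <= 32 * M * cabs w.
  rewrite -{1}(mkC_eta (q (rc (cabs w)))).
  have -> : mkC (cre (q (rc (cabs w)))) (cim (q (rc (cabs w)))) - mkC a b =
     mkC (cre (q (rc (cabs w))) - a) (cim (q (rc (cabs w))) - b).
    by apply: complex_ext; rewrite !cE.
  apply: le_trans (cabs_mk _ _) _; have := ha _ t0; have := hb _ t0; lra.
have h4 : 16 * M * cabs (w - rc (cabs w)) <= 16 * M * (2 * cabs w) by rewrite ler_wpM2l.
have -> : q w - mkC a b = (q w - q (rc (cabs w))) + (q (rc (cabs w)) - mkC a b) by ring.
have h5 := cabsD (q w - q (rc (cabs w))) (q (rc (cabs w)) - mkC a b).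
have h6 : (64 * M + 1) * cabs w < e by rewrite mulrC -ltr_pdivlMr.
have := cabs_ge0 w; nra.
Qed.

(** The quotient is the difference quotient at 0; it is holomorphic by [removable]. *)
Lemma hol_div f : hol f -> f 0 = 0 -> exists2 g, hol g & forall z, f z = z * g z.
Proof.
move=> hf f0; have [h [hc hE]] := slope_continuous (hf 0 (disc0 R)).
exists h; last by move=> z; have := hE z; rewrite f0 !subr0 mulrC.
have hd z : disc z -> z != 0 -> differentiable h z.
  by move=> zd z0; apply: (slope_differentiable hE z0); exact: hf.
move=> z zd; have [->|z0] := eqVneq z 0; last exact: hd.
exact: removable.
Qed.

(** On the circle of radius [r] the quotient has modulus at most [1 / r], and [r] may
tend to 1. *)
Lemma schwarz_div f : hol f -> f 0 = 0 -> (forall z, disc z -> cabs (f z) <= 1) ->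
  exists g, [/\ hol g, forall z, f z = z * g z & forall z, disc z -> cabs (g z) <= 1].
Proof.
move=> hf f0 f1; have [g hg fE] := hol_div hf f0.
exists g; split=> //; apply: (max_principle hg) => e e0.
have e1 : 0 < 1 + e by lra.
exists (1 + e)^-1; first by rewrite invf_lt1 //; lra.
move=> z zr z1; have z0 : 0 < cabs z by apply: lt_trans zr; rewrite invr_gt0.
have := f1 z; rewrite fE cabsM => /(_ (elimT (discP _) z1)) h.
rewrite -(ler_pM2l z0); apply: le_trans h _.
by rewrite -ler_pdivrMr // div1r ltW.
Qed.

Lemma schwarz f : hol f -> f 0 = 0 -> (forall z, disc z -> cabs (f z) <= 1) ->
  forall z, disc z -> cabs (f z) <= cabs z.
Proof.
move=> hf f0 f1 z zd; have [g [hg fE g1]] := schwarz_div hf f0 f1.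
by rewrite fE cabsM ler_piMr ?cabs_ge0 // g1.
Qed.

(** Schwarz's lemma for [(h - a) / (h + a)], where [h] is [f] shifted to have the
real value [a] at 0. *)
Lemma harnack f : hol f -> (forall z, disc z -> 0 < cre (f z)) ->
  forall z, disc z -> cre (f 0) * (1 - cabs z) <= cre (f z) * (1 + cabs z).
Proof.
move=> hf fp z zd; pose a := cre (f 0); pose h w := f w - mkC 0 (cim (f 0)).
have a0 : 0 < a by exact: fp (disc0 R).
have hh : hol h by apply: holB; [exact: hf|exact: hol_cst].
have hre w : cre (h w) = cre (f w) by rewrite /h !cE subr0.
have h0 : h 0 = rc a by apply: complex_ext; rewrite /h !cE /a; ring.
clearbody h.
have nz w : disc w -> h w + rc a != 0.
  move=> wd; apply/eqP => /(congr1 (@cre R)); rewrite !cE hre.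
  by have := fp w wd; lra.
pose u w := (h w - rc a) / (h w + rc a).
have hu : hol u.
  apply: holM; first by apply: holB; [exact: hh|exact: hol_cst].
  by apply: holV nz; apply: holD; [exact: hh|exact: hol_cst].
have u0 : u 0 = 0 by rewrite /u h0 subrr mul0r.
have usq w : cabs (h w - rc a) ^+ 2 + 4 * a * cre (f w) = cabs (h w + rc a) ^+ 2.
  by rewrite !cabs_sqr !cE hre; ring.
have u1 w : disc w -> cabs (u w) <= 1.
  move=> wd; rewrite /u cabsM cabsV ler_pdivrMr ?cabs_gt0 ?nz // mul1r.
  rewrite -(@ler_pXn2r _ 2%N) ?nnegrE ?cabs_ge0 //.
  by rewrite -usq lerDl !mulr_ge0 // ltW // fp.
have := schwarz hu u0 u1 zd.
rewrite /u cabsM cabsV ler_pdivrMr ?cabs_gt0 ?nz //.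
rewrite -(@ler_pXn2r _ 2%N) ?nnegrE ?mulr_ge0 ?cabs_ge0 // exprMn.
rewrite (cabs_sqr (h z - rc a)) (cabs_sqr (h z + rc a)) !cE hre.
rewrite -/a; have := fp z zd; move/discP: zd; have := cabs_ge0 z; move: (cabs z) (cre (f z)) (cim (h z)).
move=> t x y t0 t1 x0.
rewrite subr0 addr0 => H.
have t2 : t ^+ 2 <= 1 by rewrite expr_le1 // ltW.
have H2 : (x - a) ^+ 2 <= (t * (x + a)) ^+ 2.
  rewrite exprMn; have : 0 <= (1 - t ^+ 2) * y ^+ 2 by rewrite mulr_ge0 ?sqr_ge0 // subr_ge0.
  by move: H; lra.
suff : a - x <= t * (x + a) by lra.
have [hl|hl] := lerP (a - x) 0; first by apply: le_trans hl _; rewrite mulr_ge0 //; lra.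
rewrite -(@ler_pXn2r _ 2%N) ?nnegrE ?mulr_ge0 ?(ltW hl) //; last lra.
by rewrite -sqrrN opprB.
Qed.

End Removable.

(** * Moebius maps and the identity theorem *)

Section Identity.
Variable R : realType.
Local Notation C := (Cplx R).
Implicit Types (z w p a : C) (F G f g : C -> C).

Lemma small_pow_eq0 (x M q : R) : 0 <= x -> 0 <= M -> 0 <= q < 1 ->
  (forall k, x <= M * q ^+ k) -> x = 0.
Proof.
move=> x0 M0 hq h; apply/eqP; rewrite eq_le x0 andbT; apply/ler_addgt0Pr => e e0.
have [|k hk] := small_expr hq (e := e / (M + 1)); first by rewrite divr_gt0 //; lra.
rewrite add0r; apply: le_trans (h k) _.
apply: (@le_trans _ _ ((M + 1) * q ^+ k)).
  by rewrite ler_wpM2r ?exprn_ge0 //; [case/andP: hq | lra].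
by rewrite mulrC -ler_pdivlMr ?ltW //; lra.
Qed.

(** All quotients of [f] by powers of [z] are holomorphic, and by the maximum
principle [f p] is bounded by a constant times powers of [cabs p / r < 1]. *)
Lemma identity0 f (e : R) : hol f -> 0 < e ->
  (forall z, cabs z < e -> f z = 0) -> forall z, disc z -> f z = 0.
Proof.
move=> hf e0 fe p /discP p1.
have [->|p0] := eqVneq p 0; first by apply: fe; rewrite cabs0.
have [r pr r1] := between p1; have r0 : 0 < r by exact: le_lt_trans (cabs_ge0 p) pr.
have [|M hM] := @cont_bounded R f r.
  by move=> z zr; apply/diff_cont/hf/discP; exact: le_lt_trans zr r1.
have M0 : 0 <= M by apply: le_trans (hM p (ltW pr)); exact: cabs_ge0.
have hg k : hol (fun z => f z * (z ^+ k)^-1).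
  move=> z zd; have [->|z0] := eqVneq z 0.
    apply: (@diff_near _ (fun=> 0) _ _ e e0); last exact: dfcst.
    by move=> w; rewrite subr0 => /fe ->; rewrite mul0r.
  apply: dfM; first exact: hf.
  by apply: dfV; [apply: holX zd; exact: hol_id|rewrite expf_neq0].
apply/eqP; rewrite -cabs_eq0; apply/eqP.
apply: (@small_pow_eq0 _ M (cabs p / r)); rewrite ?cabs_ge0 //.
  by rewrite divr_ge0 ?cabs_ge0 ?(ltW r0) //= ltr_pdivrMr // mul1r.
move=> k; have := @max_circle R _ p r (M / r ^+ k) pr r1 (hg k).
rewrite cabsM cabsV cabsX expr_div_n => h.
have pk : 0 < cabs p ^+ k by rewrite exprn_gt0 // cabs_gt0.
rewrite ler_pdivrMr // mulrAC -mulrA in h; apply: h => z zr.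
rewrite cabsM cabsV cabsX zr ler_wpM2r ?invr_ge0 ?exprn_ge0 ?(ltW r0) //.
by apply: hM; rewrite zr.
Qed.

(** The automorphism of the disc that sends 0 to [a]; for [- a] it is the Blaschke
factor with zero [a]. *)
Definition mobius a z : C := (z + a) / (1 + a^* * z).

Lemma mobius_norm_id a z : cabs (1 + a^* * z) ^+ 2 =
  cabs (z + a) ^+ 2 + (1 - cabs a ^+ 2) * (1 - cabs z ^+ 2).
Proof. by rewrite !cabs_sqr !cE; ring. Qed.

Lemma mobius_den_neq0 a z : disc a -> disc z -> 1 + a^* * z != 0.
Proof.
move=> /discP a1 /discP z1; rewrite -cabs_gt0.
have := cabs_rev 1 (- (a^* * z)); rewrite opprK cabsN cabsM cabs_conj cabs1.
have : cabs a * cabs z <= cabs a * 1 by rewrite ler_wpM2l ?cabs_ge0 // ltW.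
lra.
Qed.

Lemma sqr_lt1 (x : R) : 0 <= x -> (x ^+ 2 < 1) = (x < 1).
Proof. by move=> x0; rewrite expr_lt1. Qed.

Lemma mobius_sqr a z : disc a -> disc z ->
  cabs (mobius a z) ^+ 2 = 1 - (1 - cabs a ^+ 2) * (1 - cabs z ^+ 2) / cabs (1 + a^* * z) ^+ 2.
Proof.
move=> ad zd; have nz := mobius_den_neq0 ad zd.
have n2 : cabs (1 + a^* * z) ^+ 2 != 0 by rewrite expf_neq0 // cabs_eq0.
apply: (mulIf n2); rewrite mulrBl divfK // /mobius cabsM cabsV exprMn exprVn divfK //.
by rewrite mobius_norm_id; ring.
Qed.

Lemma mobius_disc a z : disc a -> disc z -> disc (mobius a z).
Proof.
move=> ad zd; have nz := mobius_den_neq0 ad zd; apply/discP.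
rewrite -sqr_lt1 ?cabs_ge0 // mobius_sqr // ltrBlDr ltrDl.
move/discP: ad; move/discP: zd; rewrite -(sqr_lt1 (cabs_ge0 z)) -(sqr_lt1 (cabs_ge0 a)) => ? ?.
apply: divr_gt0; first by apply: mulr_gt0; rewrite subr_gt0.
by rewrite exprn_gt0 // cabs_gt0.
Qed.

Lemma discN a : disc a -> disc (- a).
Proof. by move=> /discP h; apply/discP; rewrite cabsN. Qed.

Lemma mobius0 a : mobius a 0 = a.
Proof. by rewrite /mobius mulr0 addr0 divr1 add0r. Qed.

Lemma mobiusK a z : disc a -> disc z -> mobius a (mobius (- a) z) = z.
Proof.
move=> ad zd; have nz := mobius_den_neq0 (discN ad) zd.
have nz2 : 1 - a^* * a != 0.
  by have := mobius_den_neq0 ad (discN ad); rewrite mulrN.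
have E : (- a)^* = - a^* by rewrite rmorphN.
rewrite E mulNr in nz; rewrite /mobius E mulNr; move: (a^*) nz nz2 => b nz nz2.
have -> : (z + - a) / (1 - b * z) + a = z * (1 - b * a) / (1 - b * z) by field.
have -> : 1 + b * ((z + - a) / (1 - b * z)) = (1 - b * a) / (1 - b * z) by field.
by field; rewrite nz nz2.
Qed.

Lemma hol_mobius a : disc a -> hol (mobius a).
Proof.
move=> ad; apply: holM; first by apply: holD; [exact: hol_id|exact: hol_cst].
apply: holV; last by move=> z; exact: mobius_den_neq0.
by apply: holD; [exact: hol_cst | apply: holM; [exact: hol_cst | exact: hol_id]].
Qed.

Lemma hol_mobius_comp a f : disc a -> hol f -> hol (fun z => f (mobius a z)).
Proof. by move=> ad hf; apply: hol_comp hf (hol_mobius ad) _ => z; exact: mobius_disc. Qed.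

Lemma identity_near f a (e : R) : hol f -> disc a -> 0 < e ->
  (forall z, cabs (z - a) < e -> f z = 0) -> forall z, disc z -> f z = 0.
Proof.
move=> hf ad e0 fe z zd; rewrite -(mobiusK ad zd).
have [d d0 hd] := (cont_cabsP _ _).1 (diff_cont (hol_mobius ad (disc0 R))) e e0.
apply: (identity0 (hol_mobius_comp ad hf) d0 _ (mobius_disc (discN ad) zd)) => w wd.
by apply: fe; move: (hd w); rewrite subr0 mobius0; apply.
Qed.

(** Where [f] does not vanish, neither does it nearby, so [g] vanishes on a small
disc. *)
Lemma hol_mul0 f g : hol f -> hol g -> (forall z, disc z -> f z * g z = 0) ->
  (exists2 z, disc z & f z != 0) -> forall z, disc z -> g z = 0.
Proof.
move=> hf hg fg [a ad fa].
have fa0 : 0 < cabs (f a) by rewrite cabs_gt0.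
have [d d0 hd] := (cont_cabsP _ _).1 (diff_cont (hf a ad)) _ fa0.
have a1 : 0 < 1 - cabs a by rewrite subr_gt0; exact/discP.
apply: (@identity_near g a (Num.min d (1 - cabs a)) hg ad).
  by rewrite lt_min d0.
move=> z; rewrite lt_min => /andP[zd za].
have zD : disc z by apply/discP; have := cabs_rev z a; lra.
have /eqP := fg z zD; rewrite mulf_eq0 => /orP[/eqP fz|/eqP //].
by have := hd z zd; rewrite fz sub0r cabsN ltxx.
Qed.

Lemma hol_common_neq0 (I : eqType) (s : seq I) (F : I -> C -> C) :
  (forall i, i \in s -> hol (F i)) ->
  (forall i, i \in s -> exists2 z, disc z & F i z != 0) ->
  exists2 z, disc z & forall i, i \in s -> F i z != 0.
Proof.
move=> hF h0.
suff [z zd hz] : exists2 z, disc z & \prod_(i <- s) F i z != 0.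
  by exists z => // i si; move: hz; rewrite prodf_seq_neq0 => /allP/(_ i si).
elim: s hF h0 => [|i s IH] hF h0; first by exists 0; [exact: disc0|rewrite big_nil oner_eq0].
apply: contrapT => no.
have [||z zd] := IH; [by move=> j js; apply: hF; rewrite inE js orbT|by move=> j js; apply: h0; rewrite inE js orbT|].
move/eqP; apply.
have hol2 : hol (fun w => \prod_(j <- s) F j w).
  rewrite (_ : (fun z => _) = (fun z => \prod_(j <- s | j \in s) F j z)).
    by apply: hol_prod => j js; apply: hF; rewrite inE js orbT.
  by apply/funext => w; rewrite big_seq_cond; apply: eq_bigl => j; rewrite andbT.
have zero w : disc w -> F i w * \prod_(j <- s) F j w = 0.
  move=> wd; apply: contrapT => /eqP hw; apply: no; exists w => //.
  by rewrite big_cons.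
exact: (hol_mul0 (hF i (mem_head _ _)) hol2 zero (h0 i (mem_head _ _)) zd).
Qed.

Lemma hol_factor f a : hol f -> disc a -> f a = 0 -> (forall z, disc z -> cabs (f z) <= 1) ->
  exists g, [/\ hol g, forall z, disc z -> f z = mobius (- a) z * g z &
    forall z, disc z -> cabs (g z) <= 1].
Proof.
move=> hf ad fa f1.
have [||g [hg fE g1]] := schwarz_div (hol_mobius_comp ad hf).
- by rewrite mobius0.
- by move=> z zd; apply: f1; exact: mobius_disc.
exists (fun z => g (mobius (- a) z)); split; first exact: hol_mobius_comp (discN ad) hg.
  by move=> z zd; rewrite -fE mobiusK.
by move=> z zd; apply/g1/mobius_disc => //; exact: discN.
Qed.

(** The function [1 - (f 0)^* * f] has nonnegative real part and vanishes at 0.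
Harnack's inequality, recentred by a Moebius map and applied after a shift by
a small constant, forces it to vanish everywhere. *)
Lemma max_const f : hol f -> (forall z, disc z -> cabs (f z) <= 1) -> cabs (f 0) = 1 ->
  forall z, disc z -> f z = f 0.
Proof.
move=> hf f1 f01 z zd; pose c := f 0; pose g w := (f 0)^* * f w.
have ccj : c * c^* = 1 by rewrite mulC_conj f01 expr1n.
have hg : hol g by apply: holM; [exact: hol_cst|exact: hf].
have g1 w : disc w -> cre (g w) <= 1.
  move=> wd; apply: le_trans (cre_le_cabs _) _.
  by rewrite /g cabsM cabs_conj f01 mul1r f1.
have g0 : g 0 = 1 by rewrite /g mulrC ccj.
have gz : 1 <= cre (g z).
  apply/ler_addgt0Pr => e e0; have z0 := cabs_ge0 z.
  have z1 := introT (discP _) zd.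
  pose d := e * (1 - cabs z) / 2.
  have d0 : 0 < d by rewrite divr_gt0 // mulr_gt0 // subr_gt0.
  pose k w := 1 + rc d - g (mobius z w).
  have hk : hol k.
    by apply: holB; [exact: hol_cst | exact: hol_mobius_comp].
  have kp w : disc w -> 0 < cre (k w).
    by move=> wd; have := g1 _ (mobius_disc zd wd); rewrite /k creD creN creD cre1 cre_rc; lra.
  have := harnack hk kp (discN zd).
  rewrite /k mobius0 !creD !creN cre1 cre_rc cabsN.
  have -> : mobius z (- z) = 0 by rewrite /mobius addNr mul0r.
  rewrite g0 cre1 => H.
  have H2 : (1 + d - cre (g z)) * (1 - cabs z) <= 2 * d.
    apply: le_trans H _; have : d * cabs z <= d * 1 by rewrite ler_wpM2l ?ltW.
    lra.
  have H3 : 2 * d = e * (1 - cabs z) by rewrite /d; field.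
  have z10 : 0 < 1 - cabs z by rewrite subr_gt0.
  by rewrite H3 ler_pM2r // in H2; lra.
have gc : cabs (g z) <= 1 by rewrite /g cabsM cabs_conj f01 mul1r f1.
have gz1 : g z = 1.
  have : cabs (g z) ^+ 2 <= 1 by rewrite expr_le1 ?cabs_ge0.
  rewrite cabs_sqr => h.
  have e1 : cre (g z) = 1 by apply/eqP; rewrite eq_le g1 // gz.
  rewrite e1 in h.
  apply: complex_ext; rewrite ?cre1 ?cim1 //.
  by apply/eqP; rewrite -(sqrf_eq0 (cim (g z))) eq_le sqr_ge0 andbT; lra.
by rewrite -[f z]mul1r -ccj -mulrA -/(g z) gz1 mulr1.
Qed.

End Identity.

(** * Proper self-maps of the disc *)

Section Blaschke.
Variable R : realType.
Local Notation C := (Cplx R).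
Implicit Types (z w p a : C) (F G f g B : C -> C).

Definition modulus_to_one f := forall rho : R, rho < 1 ->
  exists2 r : R, r < 1 & forall z, disc z -> r < cabs z -> rho < cabs (f z).

(** Divide out the zeros one after the other; the quotients keep modulus at most 1
and modulus tending to 1 at the circle.  All zeros lie in a disc of radius
[r0 < 1], so at a fixed point beyond it, where [B] is not 0, each factor has
modulus at most some q < 1, which bounds their number.  A quotient without zeros
has modulus 1 by the maximum principle for it and for its inverse. *)
Lemma proper_Blaschke B : hol B -> (forall z, disc z -> disc (B z)) -> modulus_to_one B ->
  finite_Blaschke B.
Proof.
move=> hB Bd Bt.
have [r0 r01 hr0] := Bt 0 ltr01.
pose dec (s : seq C) G := [/\ (forall a, a \in s -> disc a /\ cabs a <= r0),
  hol G, forall z, disc z -> B z = \prod_(a <- s) mobius (- a) z * G z,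
  forall z, disc z -> cabs (G z) <= 1 & modulus_to_one G].
have dec0 : dec [::] B.
  split=> // z zd; first by rewrite big_nil mul1r.
  by apply/ltW; have /discP := Bd z zd.
have decS s G : dec s G -> (exists2 a, disc a & G a = 0) ->
    exists a G', dec (a :: s) G'.
  move=> [hs hG BE G1 Gt] [a ad Ga].
  have [g [hg gE g1]] := hol_factor hG ad Ga G1.
  exists a, g; split=> //.
  - move=> b; rewrite inE => /orP[/eqP->|]; last exact: hs.
    split=> //; rewrite leNgt; apply/negP => /(hr0 a ad).
    by rewrite BE // Ga mulr0 cabs0 ltxx.
  - by move=> z zd; rewrite BE // gE // big_cons; ring.
  - move=> rho /Gt[r r1 hr]; exists r => // z zd zr.
    apply: lt_le_trans (hr z zd zr) _; rewrite gE // cabsM ler_piMl ?cabs_ge0 //.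
    by apply/ltW; have /discP := mobius_disc (discN ad) zd.
have [s [G [hdec Gnz]]] : exists s G, dec s G /\ forall z, disc z -> G z != 0.
  apply: contrapT => no.
  have all N : exists s G, dec s G /\ size s = N.
    elim: N => [|N [s [G [h sN]]]]; first by exists [::], B.
    have [a [G' h']] : exists a G', dec (a :: s) G'.
      apply: (decS s G h); apply: contrapT => nz; apply: no; exists s, G; split=> //.
      by move=> z zd; apply/eqP => Gz; apply: nz; exists z.
    by exists (a :: s), G'; rewrite /= sN.
  pose m := Num.max r0 0.
  have m0 : 0 <= m by rewrite le_max lexx orbT.
  have m1 : m < 1 by rewrite gt_max r01 ltr01.
  have [x mx x1] := between m1.
  have x0 : 0 < x by exact: le_lt_trans mx.
  have cx : cabs (rc x) = x by rewrite cabs_rc gtr0_norm.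
  have xd : disc (rc x) by apply/discP; rewrite cx.
  have Bx : 0 < cabs (B (rc x)).
    by apply: hr0 => //; rewrite cx; apply: le_lt_trans mx; rewrite le_max lexx.
  (* By [mobius_sqr], [1 - ka] bounds the squared modulus of every factor at [rc x],
     as the denominator there has modulus at most 2. *)
  pose ka := (1 - m ^+ 2) * (1 - x ^+ 2) / 4.
  have sq1 (t : R) : 0 <= t -> t < 1 -> 0 < 1 - t ^+ 2.
    by move=> t0 t1; rewrite subr_gt0 sqr_lt1.
  have m2 := sq1 _ m0 m1; have x2 := sq1 _ (ltW x0) x1.
  have ka0 : 0 < ka by rewrite /ka divr_gt0 // mulr_gt0.
  have ka1 : ka <= 1.
    rewrite /ka ler_pdivrMr // mul1r; apply: (@le_trans _ _ (1 * 1)); last lra.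
    by apply: ler_pM; rewrite ?(ltW m2) ?(ltW x2) // gerBl sqr_ge0.
  have bd a : disc a /\ cabs a <= r0 -> cabs (mobius (- a) (rc x)) ^+ 2 <= 1 - ka.
    move=> [ad ar]; have nd := discN ad; rewrite mobius_sqr // cabsN cx lerD2l lerN2.
    have nz := mobius_den_neq0 nd xd.
    rewrite ler_pdivlMr ?exprn_gt0 ?cabs_gt0 //.
    have c4 : cabs (1 + (- a)^* * rc x) ^+ 2 <= 4.
      have : cabs (1 + (- a)^* * rc x) <= 2.
        apply: le_trans (cabsD _ _) _; rewrite cabs1 cabsM cabs_conj cabsN cx.
        have := ler_pM (cabs_ge0 a) (ltW x0) (ltW (introT (discP _) ad)) (ltW x1).
        lra.
      move=> h; have -> : 4 = 2 ^+ 2 :> R by ring.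
      by apply: lerXn2r h; rewrite ?nnegrE ?cabs_ge0.
    apply: (@le_trans _ _ (ka * 4)); first by rewrite ler_pM2l.
    rewrite /ka divfK // ler_pM2r // lerD2l lerN2.
    apply: lerXn2r; rewrite ?nnegrE ?cabs_ge0 //.
    by apply: le_trans ar _; rewrite le_max lexx.
  have : cabs (B (rc x)) ^+ 2 = 0.
    apply: (@small_pow_eq0 _ _ 1 (1 - ka)); rewrite ?sqr_ge0 //; first lra.
    move=> N; have [s [G [[hs hG BE G1 _] sN]]] := all N.
    rewrite mul1r BE // cabsM exprMn.
    apply: (@le_trans _ _ ((1 - ka) ^+ N * 1)); last by rewrite mulr1.
    apply: ler_pM; rewrite ?sqr_ge0 //; last by rewrite expr_le1 ?cabs_ge0 ?G1.
    rewrite cabs_prod -sN; elim: (s) hs => [|a s' IH] hs.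
      by rewrite big_nil expr1n expr0.
    rewrite big_cons /= exprMn [(1 - ka) ^+ _]exprS; apply: ler_pM; rewrite ?sqr_ge0 //.
      by apply/bd/hs/mem_head.
    by apply: IH => b bs; apply: hs; rewrite inE bs orbT.
  by apply/eqP; rewrite sqrf_eq0; apply/lt0r_neq0.
have [hs hG BE G1 Gt] := hdec.
have G1' z : disc z -> cabs (G z) = 1.
  move=> zd; apply/eqP; rewrite eq_le G1 //=.
  have /max_principle := holV hG Gnz; move/(_ 1) => mp.
  have : cabs (G z)^-1 <= 1.
    apply: mp zd => e e0.
    have [|r r1 hr] := Gt (1 + e)^-1; first by rewrite invf_lt1 //; lra.
    exists r => // w wr w1; have := hr w (elimT (discP _) w1) wr.
    rewrite cabsV => h; rewrite -[1 + e]invrK lef_pV2 ?posrE ?invr_gt0 ?ltW //; last lra.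
    by apply: lt_trans h; rewrite invr_gt0; lra.
  by rewrite cabsV invf_le1 // cabs_gt0 Gnz.
have Gc := max_const hG G1 (G1' _ (disc0 R)).
have BE2 z : disc z -> B z = G 0 * \prod_(j < size s) ((z - s`_j) / (1 - (s`_j)^* * z)).
  move=> zd; rewrite BE // Gc // mulrC; congr (_ * _).
  rewrite (big_nth 0) big_mkord; apply: eq_bigr => j _.
  by rewrite /mobius rmorphN mulNr.
exists (size s), (G 0), (fun j => s`_j); split=> //.
- case: (posnP (size s)) => // s0.
  have := Bd 0 (disc0 R); rewrite BE2 ?s0; last exact: disc0.
  by rewrite big_ord0 mulr1 => /discP; rewrite G1' ?ltxx //; exact: disc0.
- by rewrite cabsE G1' ?rc1 //; exact: disc0.
- by move=> j; have [] := hs s`_j (mem_nth 0 (ltn_ord j)).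
Qed.

End Blaschke.

(** * Polynomials with all roots in the disc *)

Section Families.
Variable R : realType.
Local Notation C := (Cplx R).
Implicit Types (p q : {poly C}).

Definition disc_poly m p := exists rs : seq C,
  [/\ size rs = m, forall r, r \in rs -> disc r & p = \prod_(r <- rs) ('X - r%:P)].

Lemma disc_poly_root m p r : disc_poly m p -> root p r -> disc r.
Proof. by move=> [rs [_ h ->]]; rewrite root_prod_XsubC => /h. Qed.

Lemma disc_poly_size m p : disc_poly m p -> size p = m.+1.
Proof. by move=> [rs [<- _ ->]]; rewrite size_prod_XsubC. Qed.

Lemma disc_poly_monic m p : disc_poly m p -> p \is monic.
Proof. by move=> [rs [_ _ ->]]; exact: monic_prod_XsubC. Qed.

Lemma horner_prod_XsubC (rs : seq C) x :
  (\prod_(r <- rs) ('X - r%:P)).[x] = \prod_(r <- rs) (x - r).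
Proof. by rewrite horner_prod; apply: eq_bigr => r _; rewrite hornerXsubC. Qed.

Lemma prod_dist_le (rs : seq C) x : cabs x <= 1 -> (forall r, r \in rs -> disc r) ->
  cabs (\prod_(r <- rs) (x - r)) <= 2 ^+ size rs.
Proof.
move=> x1; elim: rs => [|r rs IH] h; first by rewrite big_nil cabs1 expr0.
rewrite big_cons cabsM exprS; apply: ler_pM; rewrite ?cabs_ge0 //.
  have := cabsB x r; have /discP : disc r by exact/h/mem_head.
  lra.
by apply: IH => s sr; apply: h; rewrite inE sr orbT.
Qed.

Lemma disc_poly_le m p x : disc_poly m p -> cabs x <= 1 -> cabs p.[x] <= 2 ^+ m.
Proof.
by move=> [rs [<- h ->]] x1; rewrite horner_prod_XsubC prod_dist_le.
Qed.

Lemma disc_poly_le_root m p x b : disc_poly m p -> cabs x <= 1 -> root p b ->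
  cabs p.[x] <= cabs (x - b) * 2 ^+ m.
Proof.
move=> [rs [<- h ->]] x1; rewrite root_prod_XsubC horner_prod_XsubC => brs.
rewrite (big_rem b) //= cabsM ler_wpM2l ?cabs_ge0 //.
apply: le_trans (prod_dist_le x1 _) _; first by move=> r /mem_rem; exact: h.
by rewrite ler_eXn2l ?ltr1n // size_rem // leq_pred.
Qed.

Lemma prod_XsubC_logderiv (rs : seq C) x : x \notin rs ->
  (\prod_(r <- rs) ('X - r%:P))^`().[x] =
  (\prod_(r <- rs) ('X - r%:P)).[x] * \sum_(r <- rs) (x - r)^-1.
Proof.
elim: rs => [|r rs IH]; first by rewrite !big_nil -polyC1 derivC horner0 mulr0.
rewrite inE negb_or => /andP[xr /IH{}IH].
rewrite !big_cons derivM derivXsubC mul1r hornerD hornerM IH !hornerM hornerXsubC.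
have h : x - r != 0 by rewrite subr_eq0.
by field.
Qed.

Lemma cre_sum (I : Type) (s : seq I) (F : I -> C) :
  cre (\sum_(i <- s) F i) = \sum_(i <- s) cre (F i).
Proof. by apply: (big_morph _ (@creD R)). Qed.

(** The Cayley transform maps the disc to the half plane of positive real part. *)
Lemma cayley_re (c r : C) : cabs c = 1 -> disc r ->
  cre ((c + r) / (c - r)) = (1 - cabs r ^+ 2) / cabs (c - r) ^+ 2.
Proof.
move=> c1 /discP r1; have h : c - r != 0.
  by rewrite subr_eq0; apply: contraTneq r1 => <-; rewrite c1 ltxx.
have h2 : cabs (c - r) ^+ 2 != 0 by rewrite expf_neq0 // cabs_eq0.
have -> : (c + r) / (c - r) = rc (cabs (c - r) ^+ 2)^-1 * ((c + r) * (c - r)^*).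
  have hw : (c - r)^* != 0 by rewrite fmorph_eq0.
  by rewrite rcV -mulC_conj; move: ((c - r)^*) hw => w hw; field; rewrite h hw.
rewrite creM cim_rc mul0r subr0 cre_rc mulrC; congr (_ / _).
rewrite -[1](expr1n _ 2%N) -c1 !cabs_sqr !cE; ring.
Qed.

(** On a monic polynomial with roots in the disc this is the sum of
[(c + r) / (c - r)] over the roots [r] ([cayley_sumE]), written through the
coefficients so that it is holomorphic in them. *)
Definition cayley_sum p m c : C := 2 * c * p^`().[c] / p.[c] - m%:R.

Lemma cayley_sumE (rs : seq C) c : c \notin rs ->
  cayley_sum (\prod_(r <- rs) ('X - r%:P)) (size rs) c = \sum_(r <- rs) (c + r) / (c - r).
Proof.
move=> crs; rewrite /cayley_sum prod_XsubC_logderiv //.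
have nz : (\prod_(r <- rs) ('X - r%:P)).[c] != 0 by rewrite -rootE root_prod_XsubC.
rewrite (mulrC _ (\sum_(r <- rs) _)) mulrA mulfK // mulr_sumr.
rewrite -sum1_size natr_sum -sumrB !big_seq; apply: eq_bigr => r rr.
have h : c - r != 0 by rewrite subr_eq0; apply: contraNneq crs => ->.
by field.
Qed.

Lemma not_disc_root (rs : seq C) c : cabs c = 1 -> (forall r, r \in rs -> disc r) -> c \notin rs.
Proof. by move=> c1 h; apply/negP => /h /discP; rewrite c1 ltxx. Qed.

Lemma cayley_re_gt0 (c r : C) : cabs c = 1 -> disc r -> 0 < cre ((c + r) / (c - r)).
Proof.
move=> c1 rd; rewrite cayley_re //; move/discP: rd => r1; apply: divr_gt0.
  by rewrite subr_gt0 sqr_lt1 ?cabs_ge0.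
rewrite exprn_gt0 // cabs_gt0 subr_eq0; apply: contraTneq r1 => <-.
by rewrite c1 ltxx.
Qed.

(** The terms of the other roots have positive real part. *)
Lemma cayley_sum_ge m p a : disc_poly m p -> root p a -> a != 0 ->
  (1 - cabs a)^-1 <= cre (cayley_sum p m (a / rc (cabs a))).
Proof.
move=> [rs [<- h ->]]; rewrite root_prod_XsubC => ars a0.
have ca0 : cabs a != 0 by rewrite cabs_eq0.
have rca0 : rc (cabs a) != 0 by rewrite rc_eq0.
set c := a / rc (cabs a).
have c1 : cabs c = 1 by rewrite cabsM cabsV cabs_rc ger0_norm ?cabs_ge0 // divff.
have a1 : 0 < 1 - cabs a by rewrite subr_gt0; exact/discP/h.
rewrite cayley_sumE ?not_disc_root // cre_sum (big_rem a) //=.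
have ca : cabs (c - a) = 1 - cabs a.
  have -> : c - a = c * rc (1 - cabs a) by rewrite rcB rc1 /c; field.
  by rewrite cabsM c1 mul1r cabs_rc gtr0_norm.
apply: (@le_trans _ _ (cre ((c + a) / (c - a)))); last first.
  rewrite lerDl big_seq sumr_ge0 // => r /mem_rem rr.
  by apply/ltW/cayley_re_gt0 => //; exact: h.
rewrite cayley_re //; last exact: h.
rewrite ca; have -> : (1 - cabs a ^+ 2) / (1 - cabs a) ^+ 2 = (1 + cabs a) * (1 - cabs a)^-1.
  by field; apply/lt0r_neq0.
by rewrite ler_peMl ?invr_ge0 ?ltW //; have := cabs_ge0 a; lra.
Qed.

(** Some term is at least the average, and a large term has a small denominator. *)
Lemma cayley_sum_root m p c (A : R) : cabs c = 1 -> disc_poly m p -> 0 < A ->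
  A <= cre (cayley_sum p m c) -> exists2 r, root p r & cabs (c - r) <= 2 * m%:R / A.
Proof.
move=> c1 [rs [<- h ->]] A0; rewrite cayley_sumE ?not_disc_root // cre_sum => hA.
apply: contrapT => no.
have : \sum_(r <- rs) cre ((c + r) / (c - r)) < A; last by rewrite ltNge hA.
have [s0|] := posnP (size rs).
  by rewrite (size0nil s0) big_nil.
case: rs h hA no => [//|r0 rs] h hA no _.
set N := size (r0 :: rs) in no *.
have m0 : 0 < N%:R :> R by rewrite ltr0n.
have -> : A = \sum_(r <- r0 :: rs) A / N%:R.
  by rewrite big_const_seq count_predT iter_addr_0 -/N -[_ *+ N]mulr_natr divfK // lt0r_neq0.
have one r : r \in r0 :: rs -> cre ((c + r) / (c - r)) < A / N%:R.
  move=> rr; have far : 2 * N%:R / A < cabs (c - r).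
    by rewrite ltNge; apply/negP => hc; apply: no; exists r => //; rewrite root_prod_XsubC.
  have cr0 : 0 < cabs (c - r) by apply: lt_trans far; rewrite divr_gt0 // mulr_gt0.
  apply: le_lt_trans (cre_le_cabs _) _; rewrite cabsM cabsV.
  rewrite ltr_pdivrMr //; apply: (@le_lt_trans _ _ 2).
    have := cabsD c r; have /discP := h r rr; rewrite c1; lra.
  move: far; rewrite ltr_pdivrMr // => far.
  rewrite mulrAC ltr_pdivlMr // mulrC; lra.
rewrite !big_cons; apply: ltr_leD; first exact/one/mem_head.
rewrite !big_seq; apply: ler_sum => r rr; apply/ltW/one.
by rewrite inE rr orbT.
Qed.

End Families.

(** * Holomorphic families of polynomials over the polydisc *)

Section Slices.
Variables (R : realType) (n : nat).
Local Notation C := (Cplx R).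
Implicit Types (z : 'rV[C]_n) (P : 'rV[C]_n -> {poly C}).

(** The bound [family_size] is required outside the polydisc too: it makes
[(P z).[x]] one fixed expression in finitely many coefficients, so that
differentiability passes from them to values. *)
Record root_family m P : Prop := RootFamily {
  family_disc : forall z, polydisc z -> disc_poly m (P z);
  family_size : forall z, (size (P z) <= m.+1)%N;
  family_diff : forall i z, polydisc z -> differentiable (fun w => (P w)`_i) z;
  family_proper : forall k (rho : R), rho < 1 -> exists2 r : R, r < 1 &
    forall z, polydisc z -> r < cabs (z ord0 k) ->
    exists2 a, root (P z) a & rho < cabs a
}.

Definition set_coord (k : 'I_n) (zeta : C) z : 'rV[C]_n :=
  \row_j (if j == k then zeta else z ord0 j).

Lemma set_coord_disc k zeta z : disc zeta -> polydisc z -> polydisc (set_coord k zeta z).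
Proof. by move=> h hz j; rewrite mxE; case: eqP. Qed.

Lemma set_coordE k zeta z : set_coord k zeta z ord0 k = zeta.
Proof. by rewrite mxE eqxx. Qed.

Lemma set_coord_id k z : set_coord k (z ord0 k) z = z.
Proof. by apply/rowP => j; rewrite mxE; case: eqP => [->|]. Qed.


Lemma polydisc0 : polydisc (0 : 'rV[C]_n).
Proof. by move=> j; rewrite mxE; exact: disc0. Qed.

Lemma hol_line (F : 'rV[C]_n -> C) (a b : 'rV[C]_n) :
  (forall z, polydisc z -> differentiable F z) ->
  (forall t, disc t -> polydisc (a + t *: b)) -> hol (fun t => F (a + t *: b)).
Proof.
move=> hF hab t td; apply: (@differentiable_comp _ _ _ _ (fun t : C => a + t *: b) F).
  apply: differentiableD; first exact: differentiable_cst.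
  by apply: differentiableZl; exact: dfid.
by apply/hF/hab.
Qed.

Lemma hol_set_coord (F : 'rV[C]_n -> C) k z :
  (forall z, polydisc z -> differentiable F z) -> polydisc z ->
  hol (fun t => F (set_coord k t z)).
Proof.
move=> hF hz; have E t : set_coord k t z = set_coord k 0 z + t *: delta_mx ord0 k.
  apply/rowP => j; rewrite !mxE eqxx /=; case: eqP => [_|jk]; rewrite /= ?mulr1 ?mulr0 ?add0r ?addr0 //.
rewrite (_ : (fun t => _) = (fun t => F (set_coord k 0 z + t *: delta_mx ord0 k))).
  by apply: hol_line hF _ => t td; rewrite -E; exact: set_coord_disc.
by apply/funext => t; rewrite E.
Qed.

Lemma hol_radial (F : 'rV[C]_n -> C) k zeta z (tau : R) : 0 < tau -> disc zeta ->
  (forall z, polydisc z -> differentiable F z) -> (forall j, cabs (z ord0 j) <= tau) ->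
  hol (fun t => F (set_coord k zeta ((t / rc tau) *: z))).
Proof.
move=> t0 zd hF hz; have rt : rc tau != 0 by rewrite rc_eq0 lt0r_neq0.
have E t : set_coord k zeta ((t / rc tau) *: z) = set_coord k zeta 0 + t *: set_coord k 0 ((rc tau)^-1 *: z).
  apply/rowP => j; rewrite !mxE; case: eqP => jk; first by rewrite mulr0 addr0.
  by rewrite add0r mulrA.
rewrite (_ : (fun t => _) = (fun t => F (set_coord k zeta 0 + t *: set_coord k 0 ((rc tau)^-1 *: z)))).
  apply: hol_line hF _ => t td; rewrite -E; apply: set_coord_disc => // j; rewrite mxE.
  apply/discP; move/discP: td => td.
  rewrite !cabsM cabsV cabs_rc gtr0_norm // -mulrA.
  apply: le_lt_trans td; rewrite ler_piMr ?cabs_ge0 //.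
  by rewrite mulrC ler_pdivrMr // mul1r.
by apply/funext => t; rewrite E.
Qed.

Lemma hol_horner (p : C -> {poly C}) m (g : C -> C) :
  (forall t, size (p t) <= m)%N -> (forall i, hol (fun t => (p t)`_i)) -> hol g ->
  hol (fun t => (p t).[g t]).
Proof.
move=> hs hp hg.
rewrite (_ : (fun t => _) = (fun t => \sum_(i < m) (p t)`_i * g t ^+ i)).
  by apply: hol_sum => i _; apply: holM; [exact: hp | exact: holX].
by apply/funext => t; rewrite (horner_coef_wide _ (hs t)).
Qed.

Lemma family_gt0 m P (k : 'I_n) : root_family m P -> (0 < m)%N.
Proof.
move=> hP; have [r r1 hr] := family_proper hP k ltr01.
have [|s] := @between R (Num.max r 0) 1; first by rewrite gt_max r1 ltr01.
rewrite gt_max => /andP[rs s0] s1.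
have zd : polydisc (set_coord k (rc s) 0).
  by apply: set_coord_disc polydisc0; apply/discP; rewrite cabs_rc gtr0_norm.
have [|a ra _] := hr _ zd; first by rewrite set_coordE cabs_rc gtr0_norm.
have [rs' [<- _ E]] := family_disc hP zd.
by move: ra; rewrite E root_prod_XsubC; case: rs' {E}.
Qed.

(** Take for [c] the direction of a root [a] near the circle at the point with all
other coordinates 0.  The Cayley sum at [c] is large there, since
[1 - cabs a] is small, and by [harnack] on the complex line through this point
and the given one it remains large. *)
Lemma family_near m P (k : 'I_n) (e tau : R) : root_family m P -> 0 < e -> 0 < tau < 1 ->
  exists2 r : R, r < 1 & forall zeta, disc zeta -> r < cabs zeta ->
  exists2 c : C, cabs c = 1 & forall z, (forall j, cabs (z ord0 j) <= tau) ->
    exists2 b, root (P (set_coord k zeta z)) b & cabs (c - b) <= e.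
Proof.
move=> hP e0 /andP[t0 t1]; have m0 := family_gt0 k hP.
have mR : 0 < m%:R :> R by rewrite ltr0n.
(* The bound for [1 - cabs a] that Harnack's inequality and [cayley_sum_root] turn
   into a root within [e] of [c]. *)
have [X XE] : exists X : R, X = e * (1 - tau) / (4 * m%:R) by eexists.
have X0 : 0 < X by rewrite XE divr_gt0 // mulr_gt0 // subr_gt0.
have rho1 : Num.max 0 (1 - X) < 1 by rewrite gt_max ltr01 /=; lra.
have [r r1 hr] := family_proper hP k rho1.
exists r => // zeta zd zr.
have d0 : polydisc (set_coord k zeta 0) by exact: set_coord_disc polydisc0.
have [|a ra] := hr _ d0; first by rewrite set_coordE.
rewrite gt_max => /andP[a0 arho].
have an0 : a != 0 by rewrite -cabs_gt0.
have a1 : 0 < 1 - cabs a.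
  by rewrite subr_gt0; apply/discP/(disc_poly_root (family_disc hP d0)).
have aX : 1 - cabs a <= X by lra.
have tau2 : 1 + tau <= 2 by lra.
have tau3 : 0 < 1 - tau by rewrite subr_gt0.
set c := a / rc (cabs a); have c1 : cabs c = 1.
  by rewrite cabsM cabsV cabs_rc ger0_norm ?cabs_ge0 // divff // cabs_eq0.
exists c => // z hz; pose p t := P (set_coord k zeta ((t / rc tau) *: z)).
have pd t : disc t -> polydisc (set_coord k zeta ((t / rc tau) *: z)).
  move=> /discP td; apply: set_coord_disc => // j; rewrite mxE; apply/discP.
  rewrite !cabsM cabsV cabs_rc gtr0_norm // -mulrA.
  apply: le_lt_trans td; rewrite ler_piMr ?cabs_ge0 //.
  by rewrite mulrC ler_pdivrMr // mul1r.
have hp i : hol (fun t => (p t)`_i).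
  by apply: (hol_radial k t0 zd (family_diff hP i) hz).
pose g t := cayley_sum (p t) m c.
have dp t : disc t -> disc_poly m (p t) by move=> /pd; exact: family_disc.
have pc t : disc t -> (p t).[c] != 0.
  move=> td; apply/negP => /(disc_poly_root (dp t td)) /discP.
  by rewrite c1 ltxx.
have hg : hol g.
  apply: holB; last exact: hol_cst.
  apply: holM; last first.
    by apply: holV pc; apply: hol_horner (fun t => family_size hP _) hp _; exact: hol_cst.
  apply: holM; first exact: hol_cst.
  apply: (@hol_horner _ m.+1); last exact: hol_cst.
    move=> t; apply: leq_trans (size_poly _ _) _; apply: leq_trans (leq_pred _) _.
    exact: family_size hP _.
  move=> i; rewrite (_ : (fun t => _) = (fun t => (p t)`_i.+1 * i.+1%:R)).
    by apply: holM; [exact: hp|exact: hol_cst].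
  by apply/funext => t; rewrite coef_deriv mulr_natr.
have gp t : disc t -> 0 < cre (g t).
  move=> td; have [rs [sz h E]] := dp t td.
  rewrite /g E -sz cayley_sumE ?not_disc_root // cre_sum.
  case: rs sz h {E} => [sz|r0 rs _ h]; first by rewrite -sz in m0.
  rewrite big_cons ltr_wpDr //; last exact/cayley_re_gt0/h/mem_head.
  rewrite big_seq sumr_ge0 // => x xr; apply/ltW/cayley_re_gt0 => //.
  by apply: h; rewrite inE xr orbT.
have g0 : (1 - cabs a)^-1 <= cre (g 0).
  rewrite /g /p mul0r scale0r; apply: cayley_sum_ge => //.
  exact: family_disc hP _ d0.
have taud : disc (rc tau) by apply/discP; rewrite cabs_rc gtr0_norm.
have := harnack hg gp taud; rewrite cabs_rc gtr0_norm // => H.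
have pz : p (rc tau) = P (set_coord k zeta z).
  have nz : rc tau != 0 by rewrite rc_eq0 lt0r_neq0.
  by rewrite /p divff // scale1r.
pose A := 2 * m%:R / e.
have A0 : 0 < A by rewrite divr_gt0 // mulr_gt0.
have hA : A <= cre (g (rc tau)).
  have ia : X^-1 <= (1 - cabs a)^-1.
    by rewrite (lef_pV2 X0 a1).
  have h1 := le_trans ia g0.
  have h2 : X^-1 * (1 - tau) <= cre (g 0) * (1 - tau).
    by apply: (ler_wpM2r (ltW tau3)).
  have h3 : X^-1 * (1 - tau) = 2 * A.
    have en0 : e != 0 by exact: lt0r_neq0.
    have mn0 : m%:R != 0 :> R by exact: lt0r_neq0.
    have tn0 : 1 - tau != 0 by apply/lt0r_neq0; rewrite subr_gt0.
    by rewrite /A XE; field; rewrite ?en0 ?mn0 ?tn0.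
  have h4 : cre (g (rc tau)) * (1 + tau) <= cre (g (rc tau)) * 2.
    by apply: ler_wpM2l; [exact/ltW/gp | exact: tau2].
  have := le_trans (le_trans h2 H) h4; rewrite h3 (mulrC 2 A) ler_pM2r //.
have [b rb hb] := cayley_sum_root c1 (dp _ taud) A0 hA.
exists b; first by rewrite -pz.
apply: le_trans hb _; rewrite /A invf_div mulrC divfK //.
by rewrite mulf_neq0 // lt0r_neq0.
Qed.

End Slices.

(** * Resultants by companion matrices *)

Section Resultant.
Variable F : fieldType.

(** The size is a parameter, since the degree of a polynomial in a family is
known only up to a propositional equality. *)
Definition companion m (p : {poly F}) : 'M[F]_m :=
  \matrix_(i, j) if (i == m.-1 :> nat) then - p`_j else (i.+1 == j :> nat)%:R.

Lemma char_poly_companion m (p : {poly F}) : p \is monic -> size p = m.+1 ->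
  char_poly (companion m p) = p.
Proof.
move=> pm sp; have e : (size p).-1 = m by rewrite sp.
rewrite /companion; case: m / e {sp}; exact: companionmxK.
Qed.

Lemma horner_char_poly m (A : 'M[F]_m) x : (char_poly A).[x] = \det (x%:M - A).
Proof.
rewrite /char_poly -horner_evalE -det_map_mx; congr (\det _); apply/matrixP => i j.
by rewrite !mxE /= horner_evalE hornerD hornerN hornerC hornerMn hornerX.
Qed.

(** The determinant of [q] evaluated at the companion matrix of [p]: a polynomial in
the coefficients which, by [companion_resE], is the resultant of [p] and [q] up
to sign. *)
Definition companion_res m (p q : {poly F}) : F :=
  \det (\sum_(i < m.+2) q`_i *: companion m.+1 p ^+ i).

(** Evaluation at a matrix and the determinant are multiplicative, and the
determinant for a linear factor is a value of the characteristic polynomial of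
the companion matrix, that is, of [p]. *)
Lemma companion_resE m p (rs : seq F) : p \is monic -> size p = m.+2 -> size rs = m.+1 ->
  companion_res m p (\prod_(r <- rs) ('X - r%:P)) =
  \prod_(r <- rs) ((-1) ^+ m.+1 * p.[r]).
Proof.
move=> pm sp srs; rewrite /companion_res; set A := companion m.+1 p; set q := \prod_(r <- rs) _.
have sq : size q = m.+2 by rewrite size_prod_XsubC srs.
have -> : \sum_(i < m.+2) q`_i *: A ^+ i = horner_mx A q.
  rewrite -{2}[q]coefK poly_def sq rmorph_sum; apply: eq_bigr => i _.
  by rewrite /= horner_mxZ rmorphXn /= horner_mx_X.
rewrite /q rmorph_prod /=.
have -> : \det (\prod_(r <- rs) horner_mx A ('X - r%:P)) =
   \prod_(r <- rs) \det (horner_mx A ('X - r%:P)).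
  by apply: (big_morph (fun M : 'M[F]_m.+1 => \det M)); [exact: det_mulmx|exact: det1].
apply: eq_bigr => r _.
rewrite rmorphB /= horner_mx_X horner_mx_C -(char_poly_companion pm sp) horner_char_poly -/A.
rewrite -detZ scaleN1r opprB; congr (\det (_ - _)).
Qed.

End Resultant.

(** * Common roots along a slice *)

Section CommonRoots.
Variables (R : realType) (n : nat).
Local Notation C := (Cplx R).
Implicit Types (z : 'rV[C]_n) (P : 'rV[C]_n -> {poly C}).

Lemma hol_det m (A : C -> 'M[C]_m) : (forall i j, hol (fun t => A t i j)) ->
  hol (fun t => \det (A t)).
Proof.
move=> hA; rewrite /determinant; apply: hol_sum => s _.
by apply: holM; [exact: hol_cst | apply: hol_prod => i _; exact: hA].
Qed.

Lemma hol_mxX m (A : C -> 'M[C]_m.+1) k : (forall i j, hol (fun t => A t i j)) ->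
  forall i j, hol (fun t => (A t ^+ k) i j).
Proof.
move=> hA; elim: k => [|k IH] i j.
  by rewrite (_ : (fun t => _) = (fun=> (1 : 'M[C]_m.+1) i j)) //; exact: hol_cst.
rewrite (_ : (fun t => _) = (fun t => \sum_l A t i l * (A t ^+ k) l j)).
  by apply: hol_sum => l _; apply: holM; [exact: hA|exact: IH].
by apply/funext => t; rewrite exprS -[_ * _]/(_ *m _) mxE.
Qed.

Lemma hol_companion_res m (p q : C -> {poly C}) : (forall i, hol (fun t => (p t)`_i)) ->
  (forall i, hol (fun t => (q t)`_i)) -> hol (fun t => companion_res m (p t) (q t)).
Proof.
move=> hp hq; apply: hol_det => i j.
rewrite (_ : (fun t => _) =
  (fun t => \sum_(l < m.+2) (q t)`_l * (companion m.+1 (p t) ^+ l) i j)).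
  apply: hol_sum => l _; apply: holM; first exact: hq.
  apply: hol_mxX => i' j'.
  rewrite (_ : (fun t => _) = (fun t => if (i' == m :> nat) then - (p t)`_j' else
     (i'.+1 == j' :> nat)%:R)); last by apply/funext => t; rewrite mxE.
  by case: eqP => _; [exact/holN/hp | exact: hol_cst].
by apply/funext => t; rewrite summxE; apply: eq_bigr => l _; rewrite mxE.
Qed.

Lemma cabs_companion_res m (p : {poly C}) (rs : seq C) : p \is monic -> size p = m.+2 ->
  size rs = m.+1 ->
  cabs (companion_res m p (\prod_(r <- rs) ('X - r%:P))) = \prod_(r <- rs) cabs p.[r].
Proof.
move=> pm sp srs; rewrite companion_resE // cabs_prod; apply: eq_bigr => r _.
by rewrite cabsM cabsX cabsN cabs1 expr1n mul1r.
Qed.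

Lemma common_bound (s : seq R) : (forall x, x \in s -> x < 1) ->
  exists2 t : R, 0 < t < 1 & forall x, x \in s -> x <= t.
Proof.
elim: s => [|x s IH] h; first by exists (1/2) => //; lra.
have [|t t01 ht] := IH; first by move=> y ys; apply: h; rewrite inE ys orbT.
exists (Num.max t x).
  by have /andP[h1 h2] := t01; rewrite lt_max gt_max h1 h2 h ?mem_head.
by move=> y; rewrite inE le_max => /orP[/eqP->|/ht->//]; rewrite lexx orbT.
Qed.

Lemma polydisc_bound z : polydisc z -> exists2 t : R, 0 < t < 1 & forall j, cabs (z ord0 j) <= t.
Proof.
move=> hz; have [|t t01 ht] := @common_bound [seq cabs (z ord0 j) | j <- enum 'I_n].
  by move=> x /mapP[j _ ->]; apply/discP/hz.
by exists t => // j; apply/ht/map_f; rewrite mem_enum.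
Qed.

Lemma prod_le_pow (rs : seq C) (f : C -> R) (T : R) : 0 <= T ->
  (forall r, r \in rs -> 0 <= f r <= T) -> \prod_(r <- rs) f r <= T ^+ size rs.
Proof.
move=> T0; elim: rs => [|r rs IH] h; first by rewrite big_nil expr0.
have /andP[f0 fT] := h r (mem_head _ _).
rewrite big_cons exprS; apply: ler_pM => //.
  rewrite big_seq; apply: prodr_ge0 => x xr.
  by have /andP[] : 0 <= f x <= T by apply: h; rewrite inE xr orbT.
by apply: IH => x xr; apply: h; rewrite inE xr orbT.
Qed.

(** Let [q] be the polynomial at [z0] and [p] that of [q] plus the combination of
the differences with [q]; it is monic, and takes the same values as the
combination at roots of [q].  Their resultant is holomorphic in [zeta].  By
[family_near], for [zeta] near the circle all polynomials involved nearly vanish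
at one point, so the resultant tends to 0 there and vanishes identically. *)
Lemma family_common_comb m P k z0 M (zs : 'I_M -> 'rV[C]_n) (t : 'I_M -> C) : root_family m P ->
  polydisc z0 -> (forall i, polydisc (zs i)) -> forall zeta, disc zeta ->
  exists2 b, root (P (set_coord k zeta z0)) b &
    \sum_(i < M) t i * (P (set_coord k zeta (zs i))).[b] = 0.
Proof.
move=> hP h0 hs.
have [m' mE] : exists m', m = m'.+1 by exists m.-1; rewrite prednK // (family_gt0 k hP).
subst m.
pose q w := P (set_coord k w z0).
pose p w := q w + \sum_(i < M) t i *: (P (set_coord k w (zs i)) - q w).
have qd w : disc w -> disc_poly m'.+1 (q w) by move=> wd; apply/(family_disc hP)/set_coord_disc.
have pd i w : disc w -> disc_poly m'.+1 (P (set_coord k w (zs i))).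
  by move=> wd; apply/(family_disc hP)/set_coord_disc.
have psz w : disc w -> size (p w) = m'.+2 /\ p w \is monic.
  move=> wd; have sq := disc_poly_size (qd w wd).
  have small : (size (\sum_(i < M) t i *: (P (set_coord k w (zs i)) - q w))%R < size (q w))%N.
    rewrite sq ltnS; apply/leq_sizeP => j mj; rewrite coef_sum; apply: big1 => i _.
    rewrite coefZ; apply/eqP; rewrite mulf_eq0; apply/orP; right; apply/eqP; move: mj.
    rewrite leq_eqVlt => /orP[/eqP<-|mj]; rewrite coefB.
      have /monicP := disc_poly_monic (pd i w wd); have /monicP := disc_poly_monic (qd w wd).
      by rewrite /lead_coef sq (disc_poly_size (pd i w wd)) /= => -> ->; rewrite subrr.
    by rewrite !nth_default ?subrr // ?sq ?(disc_poly_size (pd i w wd)).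
  split; first by rewrite /p size_polyDl.
  by rewrite monicE /p lead_coefDl //; have /monicP -> := disc_poly_monic (qd w wd).
have proot w b : root (q w) b -> (p w).[b] = \sum_(i < M) t i * (P (set_coord k w (zs i))).[b].
  move=> /rootP qb; rewrite /p hornerD qb add0r horner_sum; apply: eq_bigr => i _.
  by rewrite hornerZ hornerD hornerN qb subr0.
pose E w := companion_res m' (p w) (q w).
have hq i : hol (fun w => (q w)`_i) by exact: (hol_set_coord k (family_diff hP i) h0).
have hE : hol E.
  apply: (@hol_companion_res m' p q _ hq) => i.
  rewrite (_ : (fun w => _) = (fun w => (q w)`_i +
     \sum_(j < M) t j * ((P (set_coord k w (zs j)))`_i - (q w)`_i))).
    apply: holD; first exact: hq.
    apply: hol_sum => j _; apply: holM; first exact: hol_cst.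
    by apply: holB; [exact: (hol_set_coord k (family_diff hP i) (hs j))|exact: hq].
  by apply/funext => w; rewrite /p coefD coef_sum; congr (_ + _); apply: eq_bigr => j _;
    rewrite coefZ coefB.
have EE w : disc w -> exists2 rs : seq C, size rs = m'.+1 /\ (forall r, r \in rs = root (q w) r) &
    cabs (E w) = \prod_(r <- rs) cabs (p w).[r].
  move=> wd; have [rs [srs _ qE]] := qd w wd; exists rs.
    by split=> // r; rewrite qE root_prod_XsubC.
  by rewrite /E qE; apply: cabs_companion_res => //; have [] := psz w wd.
suff E0 w : disc w -> E w = 0.
  move=> w wd; have [rs [_ rsE] Ew] := EE w wd.
  move: Ew; rewrite E0 // cabs0 => /esym/eqP; rewrite prodf_seq_eq0 => /hasP[b brs /=].
  rewrite cabs_eq0 => /eqP pb; exists b; first by rewrite -rsE.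
  by rewrite -(proot w) // -rsE.
move=> wd; apply/eqP; rewrite -cabs_eq0 eq_le cabs_ge0 andbT.
move: w wd; apply: max_principle hE _ => e e0.
pose S := \sum_(i < M) cabs (t i); pose T := 1 + S * 2 ^+ m'.+1.
have S0 : 0 <= S by apply: sumr_ge0 => i _; exact: cabs_ge0.
have p2 : 0 < 2 ^+ m'.+1 :> R by rewrite exprn_gt0.
have T1 : 1 <= T by rewrite /T lerDl mulr_ge0 // ltW.
have T0 : 0 < T by exact: lt_le_trans T1.
have Tm : 0 < T ^+ m'.+1 by rewrite exprn_gt0.
(* The factor of the resultant at a root near [c] is at most [2 * ep * T], and each
   other factor at most [T]. *)
pose ep := e / (2 * T ^+ m'.+1).
have ep0 : 0 < ep by rewrite divr_gt0 // mulr_gt0.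
have [tau0 tau01 htau0] := polydisc_bound h0.
have [tau tau1 htau] : exists2 tau : R, 0 < tau < 1 &
    (forall j, cabs (z0 ord0 j) <= tau) /\ forall i j, cabs (zs i ord0 j) <= tau.
  have [|tau h1 h2] := @common_bound
     (tau0 :: [seq cabs (zs ij.1 ord0 ij.2) | ij <- enum {: 'I_M * 'I_n}]).
    move=> x; rewrite inE => /orP[/eqP->|]; first by case/andP: tau01.
    by move=> /mapP[[i j] _ ->]; apply/discP/hs.
  exists tau => //; split=> [j|i j]; first by apply: le_trans (htau0 j) (h2 _ (mem_head _ _)).
  by apply: h2; rewrite inE; apply/orP; right; apply/mapP; exists (i, j); rewrite ?mem_enum.
have [r r1 hr] := family_near k hP ep0 tau1.
exists r => // w wr w1; have wd : disc w by exact/discP.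
have [c c1 hc] := hr w wd wr.
have [b0 qb0 cb0] := hc z0 htau.1.
have b0d : cabs b0 <= 1 by apply/ltW/discP/(disc_poly_root (qd w wd) qb0).
have [rs [srs rsE] ->] := EE w wd; rewrite add0r.
have fT b : b \in rs -> 0 <= cabs (p w).[b] <= T.
  rewrite rsE cabs_ge0 /= => qb; rewrite (proot _ _ qb); apply: le_trans (cabs_sum _ _ _) _.
  apply: (@le_trans _ _ (S * 2 ^+ m'.+1)); last by rewrite /T lerDr.
  rewrite /S mulr_suml; apply: ler_sum => i _; rewrite cabsM ler_wpM2l ?cabs_ge0 //.
  by apply: disc_poly_le; [exact: pd | apply/ltW/discP/(disc_poly_root (qd w wd) qb)].
have f0 : cabs (p w).[b0] <= 2 * ep * T.
  rewrite (proot _ _ qb0); apply: le_trans (cabs_sum _ _ _) _.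
  apply: (@le_trans _ _ (2 * ep * (S * 2 ^+ m'.+1))); last first.
    apply: ler_wpM2l; first by rewrite mulr_ge0 // ltW.
    by rewrite /T lerDr.
  rewrite mulrC /S !mulr_suml; apply: ler_sum => i _.
  rewrite cabsM -mulrA ler_wpM2l ?cabs_ge0 //.
  have [b rb cb] := hc _ (htau.2 i).
  apply: le_trans (disc_poly_le_root (pd i w wd) b0d rb) _.
  rewrite [X in X <= _]mulrC; apply: ler_wpM2l; first exact: ltW.
  have -> : b0 - b = (c - b) - (c - b0) by ring.
  have := cabsB (c - b) (c - b0); lra.
have b0rs : b0 \in rs by rewrite rsE.
rewrite (big_rem b0) //=.
have h1 : \prod_(y <- rem b0 rs) cabs (p w).[y] <= T ^+ m'.
  apply: le_trans (prod_le_pow (ltW T0) _) _; first by move=> x /mem_rem; exact: fT.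
  by rewrite size_rem // srs.
apply: (@le_trans _ _ (2 * ep * T * T ^+ m')).
  apply: ler_pM => //; rewrite ?cabs_ge0 //.
  by apply: prodr_ge0 => *; exact: cabs_ge0.
rewrite -mulrA -exprS; have Tn : T ^+ m'.+1 != 0 by exact: lt0r_neq0.
have -> // : 2 * ep * T ^+ m'.+1 = e.
by rewrite /ep; move: (T ^+ m'.+1) Tn => X Xn; field.
Qed.

End CommonRoots.

(** * Base points with disjoint common roots *)

Section Select.
Variables (R : realType) (n : nat).
Local Notation C := (Cplx R).
Implicit Types (z : 'rV[C]_n) (P : 'rV[C]_n -> {poly C}).

Lemma poly_nonroot (p : {poly C}) : p != 0 -> exists s, p.[s] != 0.
Proof.
move=> p0; apply: contrapT => /forallNP no.
have := @max_poly_roots _ p [seq i%:R | i <- iota 0 (size p)] p0.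
rewrite size_map size_iota ltnn => h; suff : false by []; apply: h.
  by apply/allP => x _; rewrite rootE; apply: contrapT => /negP; exact: no.
rewrite map_inj_uniq ?iota_uniq // => i j /eqP; rewrite eqr_nat; exact/eqP.
Qed.

Definition slice_root P (k : 'I_n) (zeta b : C) :=
  forall z, polydisc z -> root (P (set_coord k zeta z)) b.

(** Only finitely many points [b] are candidates, the roots of one polynomial.  If
each of them fails at some point [zs j], then weights [s ^+ j] with generic [s]
make the combination of the polynomials at these points nonzero at all
candidates, against [family_common_comb]. *)
Lemma family_common m P k zeta : root_family m P -> disc zeta -> exists b, slice_root P k zeta b.
Proof.
move=> hP zd; have d0 := set_coord_disc k zd (@polydisc0 R n).
have [rs [srs _ PE]] := family_disc hP d0.
apply: contrapT => /forallNP no.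
have far (j : 'I_m) : exists z, polydisc z /\ ~~ root (P (set_coord k zeta z)) rs`_j.
  have /existsNP[z /not_implyP[hz /negP rz]] := no rs`_j.
  by exists z.
have [zs hzs] := choice far.
(* The value at the candidate [rs`_i] of the combination with weights [s ^+ j], as a
   polynomial in [s]; its [i]-th coefficient is not 0. *)
pose W (i : 'I_m) : {poly C} := \poly_(j < m) (if insub j is Some j' then (P (set_coord k zeta (zs j'))).[rs`_i] else 0).
have WE (i : 'I_m) s : (W i).[s] = \sum_(j < m) s ^+ j * (P (set_coord k zeta (zs j))).[rs`_i].
  rewrite horner_poly; apply: eq_bigr => j _; rewrite mulrC.
  by case: insubP => [j' _ /val_inj->|]; rewrite ?ltn_ord.
have W0 i : W i != 0.
  apply/eqP => /(congr1 (fun p : {poly C} => p`_i)); rewrite coef_poly ltn_ord coef0.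
  case: insubP => [j' _ /val_inj->|]; last by rewrite ltn_ord.
  by apply/eqP; have [_] := hzs i.
have [|s hs] := @poly_nonroot (\prod_(i < m) W i); first by apply/prodf_neq0.
have [b rb] := @family_common_comb R n m P k 0 m zs (fun j => s ^+ j) hP (@polydisc0 R n)
  (fun i => (hzs i).1) zeta zd.
move: rb; rewrite PE root_prod_XsubC => /(nthP 0)[j]; rewrite srs => im <-.
rewrite -(WE (Ordinal im)) => Ws; move: hs; rewrite horner_prod.
by rewrite (bigD1 (Ordinal im)) //= Ws mul0r eqxx.
Qed.

Lemma df_sum (I : Type) (r : seq I) (F : I -> 'rV[C]_n -> C) z :
  (forall i, differentiable (F i) z) -> differentiable (fun w => \sum_(i <- r) F i w) z.
Proof.
move=> h; elim: r => [|i r IH].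
  rewrite (_ : (fun w => _) = (fun=> 0)); first exact: dfcst.
  by apply/funext => w; rewrite big_nil.
rewrite (_ : (fun w => _) = (fun w => F i w + \sum_(j <- r) F j w)).
  by apply: dfD; [exact: h|exact: IH].
by apply/funext => w; rewrite big_cons.
Qed.

(** Division by a fixed monic polynomial is linear in the coefficients, and the
roots near the circle are not [s], which lies in the disc. *)
Lemma family_quotient m P s : root_family m.+1 P -> (forall z, polydisc z -> root (P z) s) ->
  root_family m (fun z => P z %/ ('X - s%:P)).
Proof.
move=> hP hs; have d0 : 'X - s%:P != 0 by rewrite polyXsubC_eq0.
have sd : disc s.
  by apply: disc_poly_root (hs 0 (@polydisc0 R n)); apply: (family_disc hP); exact: polydisc0.
split.
- move=> z hz; have [rs [srs h PE]] := family_disc hP hz.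
  have srs2 : s \in rs by have := hs z hz; rewrite PE root_prod_XsubC.
  exists (rem s rs); split; first by rewrite size_rem // srs.
    by move=> r /mem_rem; exact: h.
  by rewrite PE (big_rem s) //= mulKp.
- move=> z; rewrite size_divp // size_XsubC subn1.
  by have := family_size hP z; case: (size _).
- move=> i z hz.
  rewrite (_ : (fun w => _) = (fun w => \sum_(j < m.+2) (P w)`_j * ('X^j %/ ('X - s%:P))`_i)).
    by apply: df_sum => j; apply: dfM; [exact: (family_diff hP) | exact: dfcst].
  apply/funext => w; rewrite -{1}[P w]coefK poly_def.
  have -> : \sum_(j < size (P w)) (P w)`_j *: 'X^j = \sum_(j < m.+2) (P w)`_j *: 'X^j.
    rewrite (big_ord_widen _ (fun j => (P w)`_j *: 'X^j) (family_size hP w)) big_mkcond.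
    apply: eq_bigr => j _; case: ltnP => // h.
    by rewrite nth_default // scale0r.
  rewrite (big_morph (fun p => p %/ ('X - s%:P)) (fun p q => divpD _ p q) (div0p _)).
  by rewrite coef_sum; apply: eq_bigr => j _; rewrite divpZl coefZ.
- move=> k rho rho1.
  have r2 : Num.max rho (cabs s) < 1 by rewrite gt_max rho1; exact/discP.
  have [r r1 hr] := family_proper hP k r2; exists r => // z hz /(hr z hz)[a ra].
  rewrite gt_max => /andP[ar as_]; exists a => //.
  have := hs z hz; rewrite root_factor_theorem dvdp_eq => /eqP PE.
  move: ra; rewrite {1}PE rootM root_XsubC => /orP[//|/eqP aE].
  by move: as_; rewrite aE ltxx.
Qed.

Definition no_fixed_root P := forall s, exists2 z, polydisc z & ~~ root (P z) s.

(** If [s] is not a root of all [P z], it is not a root along some line in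
direction [k] except for isolated parameters; finitely many [s] are avoided
at once by [hol_common_neq0]. *)
Lemma slice_root_avoid m P k (S : seq C) : root_family m P -> no_fixed_root P ->
  exists2 zeta, disc zeta & forall s, s \in S -> ~ slice_root P k zeta s.
Proof.
move=> hP hn.
have [s|zs hzs] := @choice C 'rV[C]_n (fun s z => polydisc z /\ ~~ root (P z) s).
  by have [z zd hz] := hn s; exists z.
have [||z zd hz] := @hol_common_neq0 R _ S (fun s t => (P (set_coord k t (zs s))).[s]).
- move=> s _; apply: hol_horner (fun t => family_size hP _) _ (hol_cst s) => i.
  exact: (hol_set_coord k (family_diff hP i) (hzs s).1).
- move=> s _; exists (zs s ord0 k); first exact: (hzs s).1.
  by rewrite set_coord_id; exact: (hzs s).2.
exists z => // s sS /(_ _ (hzs s).1) /rootP h.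
by have := hz s sS; rewrite h eqxx.
Qed.

(** When the coordinate [k] is chosen, the common roots of the earlier coordinates
are among the roots of the single polynomial [P z], a finite set to avoid. *)
Lemma disjoint_slice_roots m P (ks : seq 'I_n) : root_family m P -> no_fixed_root P -> uniq ks ->
  exists2 z, polydisc z & forall k k' b, k \in ks -> k' \in ks -> k != k' ->
    slice_root P k (z ord0 k) b -> slice_root P k' (z ord0 k') b -> False.
Proof.
move=> hP hn; elim: ks => [_|k ks IH /= /andP[kks /IH[z zd hz]]].
  by exists 0 => //; exact: polydisc0.
have [rs [_ _ PE]] := family_disc hP zd.
have [zeta zetad hzeta] := slice_root_avoid k rs hP hn.
exists (set_coord k zeta z); first exact: set_coord_disc.
have other k' : k' \in ks -> set_coord k zeta z ord0 k' = z ord0 k'.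
  by move=> k'ks; rewrite mxE; case: eqP => // e; move: kks; rewrite -e k'ks.
have inS k' b : k' \in ks -> slice_root P k' (z ord0 k') b -> b \in rs.
  by move=> k'ks /(_ z zd); rewrite set_coord_id PE root_prod_XsubC.
move=> k1 k2 b; rewrite !inE => /orP[/eqP->|h1] /orP[/eqP->|h2].
- by rewrite eqxx.
- by rewrite set_coordE other // => _ c1 /(inS _ _ h2)/hzeta.
- by rewrite set_coordE other // => _ /(inS _ _ h1)/hzeta.
- by rewrite !other //; exact: hz.
Qed.

Lemma no_fixed_rootN P : ~ no_fixed_root P -> exists s, forall z, polydisc z -> root (P z) s.
Proof.
move=> /existsNP[s hs]; exists s => z hz; apply: contrapT => /negP rz.
by apply: hs; exists z.
Qed.

(** Induction on the degree.  A fixed root is divided out; without fixed roots a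
base point with disjoint common roots gives [n] distinct roots of one
polynomial. *)
Lemma family_degree_ge m P : (0 < n)%N -> root_family m P -> (n <= m)%N.
Proof.
move=> n0; have k0 : 'I_n := Ordinal n0.
elim: m P => [|m IH] P hP; first by have := family_gt0 k0 hP.
have [hn|/no_fixed_rootN[s hs]] := pselect (no_fixed_root P); last first.
  exact/leqW/(IH _ (family_quotient hP hs)).
have [z zd hz] := disjoint_slice_roots hP hn (enum_uniq 'I_n).
have [b hb] := choice (fun k => family_common k hP (zd k)).
have base_root_inj : injective b.
  move=> k k' e; apply/eqP/negPn/negP => kk'.
  have c2 : slice_root P k' (z ord0 k') (b k) by rewrite e; exact: hb.
  by apply: (hz k k' (b k) _ _ kk' (hb k) c2); rewrite mem_enum.
have Pz0 : P z != 0 by rewrite -size_poly_eq0 (disc_poly_size (family_disc hP zd)).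
have := max_poly_roots Pz0 (rs := [seq b k | k <- enum 'I_n]).
rewrite size_map size_enum_ord (disc_poly_size (family_disc hP zd)) ltnS; apply.
  apply/allP => _ /mapP[k _ ->]; have := hb k z zd; by rewrite set_coord_id.
by rewrite map_inj_uniq ?enum_uniq.
Qed.

Lemma family_no_fixed_root P : (0 < n)%N -> root_family n P -> no_fixed_root P.
Proof.
move=> n0 hP; apply: contrapT => /no_fixed_rootN[s hs].
have [m nE] : exists m, n = m.+1 by exists n.-1; rewrite prednK.
have hP' : root_family m.+1 P by rewrite -nE.
by have := family_degree_ge n0 (family_quotient hP' hs); rewrite nE ltnn.
Qed.

End Select.

(** * Splitting a family over the coordinates *)

Section Split.
Variables (R : realType) (n : nat).
Local Notation C := (Cplx R).
Implicit Types (z w : 'rV[C]_n) (P : 'rV[C]_n -> {poly C}).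

Lemma uniq_extra (T : eqType) (bs rs : seq T) : uniq bs -> {subset bs <= rs} ->
  size rs = (size bs).+1 -> exists x, perm_eq rs (x :: bs).
Proof.
elim: bs rs => [|b bs IH] rs /=.
  by case: rs => [|x [|y rs]] // _ _ _; exists x.
move=> /andP[bbs ub] sub srs.
have brs : b \in rs by exact/sub/mem_head.
have [|||x hx] := IH (rem b rs) => //.
- move=> y yb; have : y \in rs by apply: sub; rewrite inE yb orbT.
  rewrite (perm_mem (perm_to_rem brs)) inE => /orP[/eqP e|//].
  by move: bbs; rewrite -e yb.
- by rewrite size_rem // srs.
exists x; rewrite (perm_trans (perm_to_rem brs)) //.
rewrite -(perm_cons b) in hx; rewrite (perm_trans hx) //.
by apply/permP => a /=; rewrite addnCA.
Qed.

Lemma poly_ext (p q : {poly C}) : (forall x, p.[x] = q.[x]) -> p = q.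
Proof.
move=> h; apply/eqP; rewrite -subr_eq0; apply: contrapT => /negP /(@poly_nonroot R)[x].
by rewrite hornerD hornerN h subrr eqxx.
Qed.

Lemma disc_poly_eq m (p : {poly C}) (rs : seq C) : disc_poly m p -> size rs = m ->
  uniq rs -> (forall r, r \in rs -> root p r) -> p = \prod_(r <- rs) ('X - r%:P).
Proof.
move=> hp srs urs h.
rewrite [LHS](all_roots_prod_XsubC (rs := rs)) ?(disc_poly_size hp) ?srs //.
- by have /monicP -> := disc_poly_monic hp; rewrite scale1r.
- exact/allP.
- by rewrite uniq_rootsE.
Qed.

Section Coordinates.
Variables (P : 'rV[C]_n -> {poly C}) (z : 'rV[C]_n) (b : 'I_n -> C).
Hypothesis hP : root_family n P.
Hypothesis zd : polydisc z.
Hypothesis hb : forall k, slice_root P k (z ord0 k) (b k).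
Hypothesis hz : forall k k' x, k != k' ->
  slice_root P k (z ord0 k) x -> slice_root P k' (z ord0 k') x -> False.

(** By Vieta's formula for the sum of the roots, this is the root of
[P (set_coord k zeta z)] that remains besides the [b j] with [j != k]. *)
Definition coord_root (k : 'I_n) (zeta : C) : C :=
  - (P (set_coord k zeta z))`_n.-1 - \sum_(j < n | j != k) b j.

Lemma base_root_inj : injective b.
Proof.
move=> k k' e; apply/eqP/negPn/negP => kk'.
by apply: (hz kk' (hb k)); rewrite e; exact: hb.
Qed.

(** For [j != k] the point [b j] is a common root along the slice with the given
[j]-th coordinate, which contains the moved point. *)
Lemma coord_rootE k zeta : disc zeta ->
  P (set_coord k zeta z) = ('X - (coord_root k zeta)%:P) * \prod_(j < n | j != k) ('X - (b j)%:P).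
Proof.
move=> zetad; have ud := set_coord_disc k zetad zd.
have [rs [srs _ PE]] := family_disc hP ud.
pose bs := [seq b j | j <- enum 'I_n & j != k].
have bigbs : \prod_(r <- bs) ('X - r%:P) = \prod_(j < n | j != k) ('X - (b j)%:P).
  by rewrite big_map big_filter big_enum_cond.
have sbs : size bs = n.-1.
  have := count_predC (pred1 k) (enum 'I_n).
  rewrite (count_uniq_mem k (enum_uniq 'I_n)) mem_enum size_enum_ord => h.
  by rewrite size_map size_filter -[in RHS]h.
have n0 : (0 < n)%N by exact: leq_ltn_trans (ltn_ord k).
have [|||x hx] := @uniq_extra _ bs rs.
- by rewrite (map_inj_uniq base_root_inj) filter_uniq ?enum_uniq.
- move=> x /mapP[j]; rewrite mem_filter => /andP[jk _] ->.
  have := @hb j _ ud; have -> : z ord0 j = set_coord k zeta z ord0 j.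
    by rewrite mxE (negbTE jk).
  by rewrite set_coord_id PE root_prod_XsubC.
- by rewrite srs sbs prednK.
have PE2 : P (set_coord k zeta z) = ('X - x%:P) * \prod_(j < n | j != k) ('X - (b j)%:P).
  by rewrite PE (perm_big _ hx) big_cons bigbs.
suff -> : coord_root k zeta = x by [].
rewrite /coord_root PE -{1}srs coefPn_prod_XsubC ?srs -?lt0n // opprK (perm_big _ hx) big_cons.
have -> : \sum_(j < n | j != k) b j = \sum_(j <- bs) j.
  by rewrite big_map big_filter big_enum_cond.
by rewrite addrK.
Qed.

Lemma coord_root_cases k zeta x : disc zeta -> root (P (set_coord k zeta z)) x ->
  x = coord_root k zeta \/ exists2 j, j != k & x = b j.
Proof.
move=> zetad; rewrite coord_rootE // rootM root_XsubC => /orP[/eqP->|]; first by left.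
rewrite /root horner_prod prodf_seq_eq0 => /hasP[j _ /andP[jk]].
by rewrite hornerXsubC subr_eq0 => /eqP->; right; exists j.
Qed.

Lemma coord_root_disc k zeta : disc zeta -> disc (coord_root k zeta).
Proof.
move=> zetad; apply: disc_poly_root (family_disc hP (set_coord_disc k zetad zd)) _.
by rewrite coord_rootE // rootM root_XsubC eqxx.
Qed.

Lemma hol_coord_root k : hol (coord_root k).
Proof.
apply: holB; last exact: hol_cst.
apply: holN; exact: (hol_set_coord k (family_diff hP _) zd).
Qed.

Lemma base_root_disc k : disc (b k).
Proof.
apply: (disc_poly_root (family_disc hP zd)).
by have := @hb k _ zd; rewrite set_coord_id.
Qed.

(** The other roots [b j] are fixed points of the disc, so a root near the circle
must be the moving one. *)
Lemma coord_root_to_one k : modulus_to_one (coord_root k).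
Proof.
move=> rho rho1.
have [|t /andP[t0 t1] ht] := @common_bound R (rho :: [seq cabs (b j) | j <- enum 'I_n]).
  by move=> x; rewrite inE => /orP[/eqP->//|/mapP[j _ ->]]; exact/discP/base_root_disc.
have [r r1 hr] := family_proper hP k t1; exists r => // zeta zetad zr.
have [|a ra ta] := hr _ (set_coord_disc k zetad zd); first by rewrite set_coordE.
have [<-|[j _ aE]] := coord_root_cases zetad ra; first by apply: le_lt_trans ta; apply/ht/mem_head.
move: ta; rewrite aE ltNge ht // inE; apply/orP; right; apply/mapP.
by exists j; rewrite ?mem_enum.
Qed.

(** Otherwise, for a generic value [t] of the [k]-th coordinate, [coord_root k t] is
not a common root along the slice.  Neither is any [b j] with [j != k], since at
the base point the common roots for [k] and [j] are disjoint.  But some root of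
the polynomial at the moved base point is a common root, by [family_common]. *)
Lemma coord_root_global k w : polydisc w -> root (P w) (coord_root k (w ord0 k)).
Proof.
move=> wd; apply: contrapT => /negP no.
have far j : exists w', polydisc w' /\ (j != k -> ~~ root (P (set_coord k (z ord0 k) w')) (b j)).
  have [->|jk] := eqVneq j k; first by exists 0; split=> //; exact: polydisc0.
  apply: contrapT => /forallNP h; apply: (hz jk (hb j)) => w' w'd.
  by apply: contrapT => /negP nr; apply: (h w').
have [ws hws] := choice far.
pose F j t := if j == k then (P (set_coord k t w)).[coord_root k t] else (P (set_coord k t (ws j))).[b j].
have [||t td ht] := @hol_common_neq0 R _ (enum 'I_n) F.
- move=> j _; rewrite /F; case: eqP => jk.
    apply: hol_horner (fun t => family_size hP _) _ (hol_coord_root k) => i.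
    exact: (hol_set_coord k (family_diff hP i) wd).
  apply: hol_horner (fun t => family_size hP _) _ (hol_cst _) => i.
  exact: (hol_set_coord k (family_diff hP i) (hws j).1).
- move=> j _; rewrite /F; case: eqP => [_|/eqP jk].
    by exists (w ord0 k); [exact: wd|rewrite set_coord_id].
  by exists (z ord0 k); [exact: zd|have := (hws j).2 jk].
have [x hx] := family_common k hP td.
have [xE|[j jk xE]] := coord_root_cases td (hx z zd).
  have := ht k; rewrite mem_enum /F eqxx => /(_ isT).
  by have /rootP := hx w wd; rewrite xE => ->; rewrite eqxx.
have := ht j; rewrite mem_enum /F (negbTE jk) => /(_ isT).
by have /rootP := hx _ (hws j).1; rewrite xE => ->; rewrite eqxx.
Qed.

Lemma family_prod_distinct w : polydisc w ->
  (forall j l : 'I_n, j != l -> coord_root j (w ord0 j) != coord_root l (w ord0 l)) ->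
  P w = \prod_(j < n) ('X - (coord_root j (w ord0 j))%:P).
Proof.
move=> wd hd.
rewrite (@disc_poly_eq n _ [seq coord_root j (w ord0 j) | j <- enum 'I_n] (family_disc hP wd)).
- by rewrite big_map big_enum.
- by rewrite size_map size_enum_ord.
- rewrite map_inj_uniq ?enum_uniq // => j l e; apply/eqP/negPn/negP => /hd.
  by rewrite e eqxx.
- by move=> _ /mapP[j _ ->]; exact: coord_root_global.
Qed.

(** Points where some of the roots [coord_root j (w ord0 j)] coincide are reached by
removing coincidences one coordinate at a time: in the coordinate [k] both sides
are holomorphic, and they agree where [V] does not vanish. *)
Lemma family_prod w : polydisc w -> P w = \prod_(j < n) ('X - (coord_root j (w ord0 j))%:P).
Proof.
suff H i : (i <= n)%N -> forall w, polydisc w ->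
    (forall j l : 'I_n, (i <= j)%N -> (i <= l)%N -> j != l ->
       coord_root j (w ord0 j) != coord_root l (w ord0 l)) ->
    P w = \prod_(j < n) ('X - (coord_root j (w ord0 j))%:P).
  move=> wd; apply: (H n (leqnn n) w wd) => j l.
  by rewrite leqNgt ltn_ord.
elim: i => [_ {}w wd hw|i IH i_n {}w wd hw].
  by apply: family_prod_distinct => // j l jl; exact: hw.
pose k := Ordinal i_n.
apply: poly_ext => x; rewrite horner_prod.
pose V t := \prod_(j < n | j != k) (coord_root k t - coord_root j (w ord0 j)).
pose h t := (P (set_coord k t w)).[x] - \prod_(j < n) (x - coord_root j (set_coord k t w ord0 j)).
have hV : hol V.
  by apply: hol_prod => j _; apply: holB; [exact: hol_coord_root|exact: hol_cst].
have hh : hol h.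
  apply: holB.
    apply: hol_horner (fun t => family_size hP _) _ (hol_cst _) => c.
    exact: (hol_set_coord k (family_diff hP c) wd).
  apply: hol_prod => j _; apply: holB; first exact: hol_cst.
  rewrite (_ : (fun t => _) = (fun t => coord_root j (if j == k then t else w ord0 j))).
    by case: eqP => _; [exact: hol_coord_root|exact: hol_cst].
  by apply/funext => t; rewrite mxE.
have V0 : exists2 t, disc t & V t != 0.
  have [||t td ht] := @hol_common_neq0 R _ (enum 'I_n)
    (fun j t => if j == k then 1 else coord_root k t - coord_root j (w ord0 j)).
  - move=> j _; case: eqP => _; first exact: hol_cst.
    by apply: holB; [exact: hol_coord_root|exact: hol_cst].
  - move=> j _; case: eqP => _; first by exists 0; [exact: disc0|exact: oner_neq0].
    have [r r1 hr] := coord_root_to_one k (introT (discP _) (coord_root_disc j (wd j))).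
    have [|s] := @between R (Num.max r 0) 1; first by rewrite gt_max r1 ltr01.
    rewrite gt_max => /andP[rs s0] s1.
    have sE : cabs (rc s) = s by rewrite cabs_rc gtr0_norm.
    have sd : disc (rc s) by apply/discP; rewrite sE.
    exists (rc s) => //; rewrite subr_eq0.
    have := hr _ sd; rewrite sE => /(_ rs) lt; apply: contraTneq lt => ->.
    by rewrite ltxx.
  exists t => //; apply/prodf_neq0 => j jk.
  by have := ht j; rewrite mem_enum (negbTE jk) => /(_ isT).
have Vh t : disc t -> V t * h t = 0.
  move=> td; have [->|Vt] := eqVneq (V t) 0; first by rewrite mul0r.
  rewrite /h (IH (ltnW i_n) (set_coord k t w)); last 2 first.
  - exact: set_coord_disc.
  - have Vne j : j != k -> coord_root k t != coord_root j (w ord0 j).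
      move=> jk; move: Vt; rewrite /V => /prodf_neq0/(_ j jk).
      by rewrite subr_eq0.
    move=> j l ij il jl; rewrite !mxE.
    case: (eqVneq j k) => [jk|jk]; case: (eqVneq l k) => [lk|lk].
    + by move: jl; rewrite jk lk eqxx.
    + by rewrite jk; exact: Vne.
    + by rewrite lk eq_sym; exact: Vne.
    + apply: hw => //; rewrite ltn_neqAle ?ij ?il andbT eq_sym.
        by move: jk; rewrite -val_eqE.
      by move: lk; rewrite -val_eqE.
  rewrite horner_prod; under eq_bigr do rewrite hornerXsubC.
  by rewrite subrr mulr0.
have := hol_mul0 hV hh Vh V0 (wd k); rewrite /h set_coord_id => /eqP; rewrite subr_eq0 => /eqP ->.
by apply: eq_bigr => j _; rewrite hornerXsubC.
Qed.

End Coordinates.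

Lemma family_split P : (0 < n)%N -> root_family n P -> exists B : 'I_n -> C -> C,
  (forall j, finite_Blaschke (B j)) /\
  forall z, polydisc z -> P z = \prod_(j < n) ('X - (B j (z ord0 j))%:P).
Proof.
move=> n0 hP; have hn := family_no_fixed_root n0 hP.
have [z zd hz] := disjoint_slice_roots hP hn (enum_uniq 'I_n).
have [b hb] := choice (fun k => family_common k hP (zd k)).
have hz' k k' x : k != k' -> slice_root P k (z ord0 k) x -> slice_root P k' (z ord0 k') x -> False.
  by apply: hz; rewrite mem_enum.
exists (coord_root P z b); split=> [j|w wd]; last exact: family_prod.
apply: proper_Blaschke; [exact: hol_coord_root | | exact: coord_root_to_one].
by move=> t td; exact: coord_root_disc.
Qed.

End Split.

(** * The polynomial with given elementary symmetric functions *)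

Section Vieta.
Variables (R : realType) (n : nat).
Local Notation C := (Cplx R).
Implicit Types (u v z : 'rV[C]_n).

Definition elem_poly u : {poly C} :=
  'X^n + \sum_(k < n) ((-1) ^+ k.+1 * u ord0 k) *: 'X^(n - k.+1).

(** Vieta: expand the product over the set [J] of factors that contribute their
root, and collect the sets of equal cardinality. *)
Lemma elem_poly_symmap u : elem_poly (symmap u) = \prod_(j < n) ('X - (u ord0 j)%:P).
Proof.
have -> : \prod_(j < n) ('X - (u ord0 j)%:P) = \prod_(j < n) (- (u ord0 j)%:P + 'X).
  by apply: eq_bigr => j _; rewrite addrC.
rewrite bigA_distr /=.
have term (J : {set 'I_n}) : \prod_(j < n) (if j \in J then - (u ord0 j)%:P else 'X) =
    ((-1) ^+ #|J| * \prod_(j in J) u ord0 j) *: 'X^(n - #|J|) :> {poly C}.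
  rewrite (bigID (mem J)) /=.
  rewrite (eq_bigr (fun j => - (u ord0 j)%:P)); last by move=> j ->.
  rewrite [X in _ * X](eq_bigr (fun=> 'X)); last by move=> j /negbTE ->.
  rewrite -mul_polyC rmorphM rmorph_prod rmorphXn rmorphN1 /=.
  rewrite [X in X * _](_ : _ = (-1) ^+ #|J| * \prod_(j in J) (u ord0 j)%:P); last first.
    by rewrite -prodrN.
  congr (_ * _); rewrite [LHS]prodr_const; congr (_ ^+ _).
  by have h := etrans (cardC (mem J)) (card_ord n); rewrite -(addKn #|J| #|_|); congr (_ - _)%N; rewrite -[RHS]h; congr (_ + _)%N; apply: eq_card.
rewrite (eq_bigr _ (fun J _ => term J)).
rewrite (partition_big (fun J : {set 'I_n} => inord #|J| : 'I_n.+1) xpredT) //=.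
have cJ (J : {set 'I_n}) : (#|J| < n.+1)%N by rewrite ltnS -[n in (_ <= n)%N]card_ord max_card.
rewrite big_ord_recl; congr (_ + _).
  rewrite (big_pred1 (finset.set0 : {set _})) ?cards0 ?subn0 ?expr0 ?mul1r ?big_set0 ?scale1r // => J.
  by rewrite -val_eqE /= inordK // cards_eq0.
apply: eq_bigr => k _; rewrite mxE mulr_sumr scaler_suml.
apply: eq_big => J; first by rewrite -val_eqE /= inordK.
by move=> /eqP->.
Qed.

Lemma coef_elem_poly u i : (elem_poly u)`_i = (i == n)%:R +
  \sum_(k < n) ((-1) ^+ k.+1 * u ord0 k) * (i == n - k.+1)%N%:R.
Proof.
rewrite /elem_poly coefD coefXn coef_sum; congr (_ + _); apply: eq_bigr => k _.
by rewrite coefZ coefXn.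
Qed.

Lemma coef_elem_poly_ord u (k : 'I_n) : (elem_poly u)`_(n - k.+1) = (-1) ^+ k.+1 * u ord0 k.
Proof.
have kn := ltn_ord k.
rewrite coef_elem_poly (_ : (n - k.+1 == n)%N = false) ?add0r; last first.
  by apply/negbTE; rewrite neq_ltn ltn_subrL (leq_ltn_trans _ kn).
rewrite (bigD1 k) //= eqxx mulr1 big1 ?addr0 // => j jk.
rewrite (_ : (_ == _)%N = false) ?mulr0 //; apply/negbTE; apply: contra jk => /eqP h.
have jn := ltn_ord j; apply/eqP/val_inj => /=.
by apply: succn_inj; rewrite -[LHS](subKn jn) -h subKn.
Qed.

Lemma elem_poly_inj : injective elem_poly.
Proof.
move=> u v e; apply/rowP => k.
have : (elem_poly u)`_(n - k.+1) = (elem_poly v)`_(n - k.+1) by rewrite e.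
rewrite !coef_elem_poly_ord => /mulfI; apply.
by rewrite expf_neq0 // oppr_eq0 oner_eq0.
Qed.

Lemma size_elem_poly u : (size (elem_poly u) <= n.+1)%N.
Proof.
apply/leq_sizeP => j nj; rewrite coef_elem_poly gtn_eqF // add0r big1 // => k _.
by rewrite gtn_eqF ?mulr0 //; apply: leq_ltn_trans nj; exact: leq_subr.
Qed.

End Vieta.

(** * Proper maps and Blaschke products on the closed disc *)

Section Topology.
Variables (R : realType) (n : nat).
Local Notation C := (Cplx R).
Implicit Types (z : 'rV[C]_n) (f : 'rV[C]_n -> 'rV[C]_n).

Lemma compact_polydisc (r : R) : compact [set z : 'rV[C]_n | forall j, cabs (z ord0 j) <= r].
Proof.
by apply: (@rV_compact C n (fun _ => [set x : C | cabs x <= r])) => _; exact: compact_cdisc.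
Qed.

Lemma symmap_continuous : continuous (@symmap R n).
Proof.
move=> z; pose g (k : 'I_n) (w : 'rV[C]_n) :=
  \sum_(J : {set 'I_n} | #|J| == k.+1) \prod_(j in J) w ord0 j.
have coord j (w : 'rV[C]_n) : differentiable (fun w : 'rV[C]_n => w ord0 j) w.
  exact: differentiable_coord.
have dprod (s : seq 'I_n) : differentiable (fun w : 'rV[C]_n => \prod_(j <- s) w ord0 j) z.
  elim: s => [|j s IH].
    rewrite (_ : (fun w => _) = (fun=> 1)); first exact: dfcst.
    by apply/funext => w; rewrite big_nil.
  rewrite (_ : (fun w => _) = (fun w : 'rV[C]_n => w ord0 j * \prod_(i <- s) w ord0 i)).
    by apply: dfM; [exact: coord|exact: IH].
  by apply/funext => w; rewrite big_cons.
have dg k : differentiable (g k) z.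
  rewrite (_ : g k = (fun w : 'rV[C]_n => \sum_(J <- enum [pred J : {set 'I_n} | #|J| == k.+1])
     \prod_(j <- enum J) w ord0 j)).
    by apply: df_sum => J; exact: dprod.
  apply/funext => w; rewrite /g big_enum; apply: eq_bigr => J _.
  by rewrite big_enum.
apply: differentiable_continuous.
rewrite (_ : @symmap R n = (fun w => \sum_(k < n) g k w *: (delta_mx ord0 k : 'rV[C]_n))).
  rewrite (_ : (fun w => _) = \sum_(k < n) (fun w => g k w *: (delta_mx ord0 k : 'rV[C]_n))).
    by apply: differentiable_sum => k; exact: differentiableZl.
  by apply/funext => w; rewrite fct_sumE.
apply/funext => w; rewrite [LHS]row_sum_delta; apply: eq_bigr => k _.
by rewrite mxE.
Qed.

(** The points with all roots in a closed disc of radius [rho' < 1] form a compact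
subset [K] of the symmetrized polydisc, and on its preimage, which is compact in
the open polydisc, the coordinate [k] stays away from the circle. *)
Lemma family_of_proper_map f : set_fun (@polydisc R n) (@symdisc R n) f ->
  holomorphic_on (@polydisc R n) f ->
  proper_map (@polydisc R n) (@symdisc R n) f -> root_family n (fun z => elem_poly (f z)).
Proof.
move=> fm fh fp; split.
- move=> z zd; have [mu mud <-] := fm z zd.
  exists [seq mu ord0 j | j <- enum 'I_n]; split.
  + by rewrite size_map size_enum_ord.
  + by move=> _ /mapP[j _ ->]; exact: mud.
  + by rewrite elem_poly_symmap big_map big_enum.
- by move=> z; exact: size_elem_poly.
- move=> i z zd.
  rewrite (_ : (fun w => _) = (fun w => (i == n)%:R +
     \sum_(k < n) ((-1) ^+ k.+1 * f w ord0 k) * (i == n - k.+1)%N%:R)).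
    apply: dfD; first exact: dfcst.
    apply: df_sum => k; apply: dfM; last exact: dfcst.
    apply: dfM; first exact: dfcst.
    apply: (@differentiable_comp _ _ _ _ f (fun v : 'rV[C]_n => v ord0 k)); first exact: fh.
    exact: differentiable_coord.
  by apply/funext => w; rewrite coef_elem_poly.
move=> k rho rho1; pose rho' := Num.max rho 0.
have rho'1 : rho' < 1 by rewrite gt_max rho1 ltr01.
pose K := @symmap R n @` [set z : 'rV[C]_n | forall j, cabs (z ord0 j) <= rho'].
have KG : K `<=` @symdisc R n.
  move=> _ [mu hmu <-]; exists mu => // j; apply/discP; exact: le_lt_trans (hmu j) rho'1.
have Kc : compact K.
  apply: continuous_compact; last exact: compact_polydisc.
  by apply: continuous_subspaceT; exact: symmap_continuous.
have Sc := fp K KG Kc; set S := _ `&` _ in Sc.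
have [r r1 hr] : exists2 r : R, r < 1 & forall z, S z -> cabs (z ord0 k) <= r.
  have [->|/set0P S0] := eqVneq S set0; first by exists 0.
  have [|x xS hx] := @compact_EVT_max _ R (fun z : 'rV[C]_n => cabs (z ord0 k)) S S0 Sc.
    apply: continuous_subspaceT => z.
    apply: (@continuous_comp _ _ _ (fun z : 'rV[C]_n => z ord0 k) (@cabs R)).
      exact: coord_continuous.
    exact: cabs_continuous.
  exists (cabs (x ord0 k)).
    by move: xS; rewrite inE => -[xd _]; apply/discP/xd.
  by move=> z Sz; apply: hx; rewrite inE.
exists r => // z zd zr; have [mu mud fE] := fm z zd.
have [|/existsNP[j /negP]] := pselect (forall j, cabs (mu ord0 j) <= rho').
  move=> hmu; have : S z by split=> //; exists mu.
  by move=> /hr; rewrite leNgt zr.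
rewrite -ltNge => hj; exists (mu ord0 j).
  rewrite -fE elem_poly_symmap /root horner_prod prodf_seq_eq0; apply/hasP; exists j.
    by rewrite mem_index_enum.
  by rewrite hornerXsubC subrr /=.
by apply: le_lt_trans hj; rewrite le_max lexx.
Qed.

Lemma cont_prod (I : Type) (s : seq I) (F : I -> C -> C) (z : C) :
  (forall i, {for z, continuous (F i)}) ->
  {for z, continuous (fun w => \prod_(i <- s) F i w)}.
Proof.
move=> h; elim: s => [|i s IH].
  rewrite (_ : (fun w => _) = (fun=> 1)); first exact: cont_cst.
  by apply/funext => w; rewrite big_nil.
rewrite (_ : (fun w => _) = (fun w => F i w * \prod_(j <- s) F j w)).
  by apply: contM; [exact: h|exact: IH].
by apply/funext => w; rewrite big_cons.
Qed.

(** The formula of a Blaschke product makes sense on the closed disc, where the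
denominators do not vanish, and its factors are unimodular on the circle because
[cabs (z - a) = cabs (1 - a^* * z)] when [cabs z = 1]. *)
Lemma Blaschke_extend (B : C -> C) : finite_Blaschke B -> exists B', [/\
  forall z : C, disc z -> B z = B' z,
  forall z : C, cabs z <= 1 -> {for z, continuous B'} &
  forall z : C, cabs z = 1 -> cabs (B' z) = 1].
Proof.
move=> [N [c [a [_ c1 ad BE]]]].
exists (fun z : C => c * \prod_(j < N) ((z - a j) / (1 - (a j)^* * z))).
have c1' : cabs c = 1 by apply: (@rcI R); rewrite -cabsE c1.
have nz j (z : C) : cabs z <= 1 -> 1 - (a j)^* * z != 0.
  move=> z1; rewrite -cabs_gt0.
  have := cabs_rev 1 ((a j)^* * z); rewrite cabs1 cabsM cabs_conj.
  have /discP := ad j; have : cabs (a j) * cabs z <= cabs (a j) * 1.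
    by rewrite ler_wpM2l ?cabs_ge0.
  lra.
split=> // z z1.
  apply: contM; first exact: cont_cst.
  apply: cont_prod => j; apply: contM.
    by apply: contB; [exact: cont_idC|exact: cont_cst].
  apply: contV; last exact: nz.
  apply: contB; first exact: cont_cst.
  by apply: contM; [exact: cont_cst|exact: cont_idC].
rewrite cabsM c1' mul1r cabs_prod big1 // => j _.
have nj := nz j z (eq_ind_r (fun x => x <= 1) (lexx 1) z1).
rewrite cabsM cabsV; have -> : cabs (z - a j) = cabs (1 - (a j)^* * z).
  have -> : z - a j = z * (1 - (a j)^* * z)^*.
    have -> : (1 - (a j)^* * z)^* = 1 - a j * z^* by apply: complex_ext; rewrite !cE; ring.
    by rewrite mulrBr mulr1 mulrCA mulC_conj z1 expr1n rc1 mulr1.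
  by rewrite cabsM cabs_conj z1 mul1r.
by rewrite divff // cabs_eq0.
Qed.

(** Replace the [B j] by their extensions to the closed disc.  The preimage of a
compact [K] in the closed polydisc is closed, and it contains no point with a
unimodular coordinate, since there one root of the polynomial would be
unimodular. *)
Lemma Blaschke_proper f (B : 'I_n -> C -> C) :
  (forall j, finite_Blaschke (B j)) ->
  (forall z, polydisc z -> f z = symmap (\row_(j < n) B j (z ord0 j))) ->
  proper_map (@polydisc R n) (@symdisc R n) f.
Proof.
move=> hB fE K KG Kc.
have [B' hB'] := choice (fun j => Blaschke_extend (hB j)).
pose g (z : 'rV[C]_n) := symmap (\row_(j < n) B' j (z ord0 j)).
have fg z : polydisc z -> f z = g z.
  move=> zd; rewrite fE //; congr (symmap _); apply/rowP => j; rewrite !mxE.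
  by have [h _ _] := hB' j; exact: h.
pose T := [set z : 'rV[C]_n | forall j, cabs (z ord0 j) <= 1].
have Tc : compact T := @compact_polydisc 1.
have gc z : T z -> {for z, continuous g}.
  move=> zT; apply: (@continuous_comp _ _ _ (fun z : 'rV[C]_n => \row_(j < n) B' j (z ord0 j)) (@symmap R n)).
    apply/(@cvg_ballP _ _ _ _ (nbhs_filter z)) => e e0.
    have : nbhs z (fun w : 'rV[C]_n => forall j : 'I_n, ball (B' j (z ord0 j)) e (B' j (w ord0 j))).
      apply: (@filter_forall _ _ _ _ (nbhs_filter z)) => j.
      have hc : {for z, continuous (fun w : 'rV[C]_n => B' j (w ord0 j))}.
        apply: (@continuous_comp _ _ _ (fun w : 'rV[C]_n => w ord0 j) (B' j)).
          exact: coord_continuous.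
        by have [_ h _] := hB' j; exact: h (zT j).
      by move/(@cvg_ballP _ _ _ _ (nbhs_filter z)): hc; apply.
    by apply: filterS => w hw; split=> // i j; rewrite !mxE; exact: hw.
  exact: symmap_continuous.
have -> : @polydisc R n `&` f @^-1` K = T `&` g @^-1` K.
  apply/seteqP; split=> z /=.
    move=> [zd fz]; split; last by rewrite -fg.
    by move=> j; apply/ltW/discP/zd.
  move=> [zT gz]; have [mu mud muE] := KG _ gz.
  have zd : polydisc z.
    move=> j; apply/discP; rewrite lt_neqAle zT andbT; apply/negP => /eqP zj.
    have [_ _ /(_ _ zj)] := hB' j.
    have : root (elem_poly (g z)) (B' j (z ord0 j)).
      rewrite /g elem_poly_symmap /root horner_prod prodf_seq_eq0; apply/hasP; exists j.
        by rewrite mem_index_enum.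
      by rewrite hornerXsubC mxE subrr /=.
    rewrite -muE elem_poly_symmap /root horner_prod prodf_seq_eq0 => /hasP[i _ /=].
    rewrite hornerXsubC subr_eq0 => /eqP ->.
    by have /discP := mud i => lt1 e; rewrite e ltxx in lt1.
  by split=> //; rewrite fg.
have hT : closed T by apply: compact_closed Tc; exact: norm_hausdorff.
have hK : closed K by apply: compact_closed Kc; exact: norm_hausdorff.
apply: (subclosed_compact _ Tc); last by move=> z [].
move=> z clz; have zT : T z.
  by apply: hT => V /clz[w [[wT _] Vw]]; exists w.
split=> //; apply: hK => V Vg.
by have [w [[_ Kw] Vw]] := clz _ (gc z zT V Vg); exists (g w).
Qed.

End Topology.

Theorem theorem2 (R : realType) (n : nat) (hn : (1 <= n)%N)
    (f : 'rV[Cplx R]_n -> 'rV[Cplx R]_n)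
    (f_maps : set_fun (@polydisc R n) (@symdisc R n) f)
    (f_hol : holomorphic_on (@polydisc R n) f) :
  proper_map (@polydisc R n) (@symdisc R n) f <->
  exists B : 'I_n -> Cplx R -> Cplx R,
    (forall j, finite_Blaschke (B j)) /\
    forall z, polydisc z -> f z = symmap (\row_(j < n) B j (z ord0 j)).
Proof.
split=> [fp|[B [hB fE]]]; last exact: Blaschke_proper hB fE.
have [B [hB BE]] := family_split hn (family_of_proper_map f_maps f_hol fp).
exists B; split=> // z zd; apply: elem_poly_inj.
rewrite BE // elem_poly_symmap; apply: eq_bigr => j _.
by rewrite mxE.
Qed.
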